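(* Let $C\ge 200$ be an absolute constant with the following property (such a constant exists): for all integers $m\ge1$, $n\ge Cm^{4.5}$, all $b\in\mathbb{R}^m$ with $\|b^-\|_2\le n/10$, and $A\in\mathbb{R}^{m\times n}$, $c\in\mathbb{R}^n$ with i.i.d. $\mathcal{N}(0,1)$ entries, one has $\Pr\left(\mathsf{IPGAP}(A,b,c)\ge 10^{15} t\, \frac{m^{2.5}(m+\log n)^2}{n}\right)\le 4(1-\frac1{25})^t+n^{-7}$ for all $1\le t\le \frac{n}{Cm^{2.5}(m+\log n)^2}$. Then there is an absolute constant $K>0$ such that, for every $m\in\mathbb{N}$ (positive integers), every integer $n\ge Cm^{4.5}$, every $b\in\mathbb{R}^m$ with $\|b^-\|_2\le n/10$, $A\in\mathbb{R}^{m\times n}$ and $c\in\mathbb{R}^n$ with i.i.d. $\mathcal{N}(0,1)$ entries, and every $1\le t\le \frac{n}{Cm^{2.5}(m+\log n)^2}$: with probability at least $1-4(1-\frac{1}{25})^t-2/n^7$, the size of any best bound first branch-and-bound tree for solving $\max\{c^{\mathsf T}x : Ax\le b,\ x\in\{0,1\}^n\}$ is at most $$e^{K\sqrt{t}\,m^{2.25}}\; n^{K\sqrt{t}\,m^{1.25}}.$$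
   Context: For $A\in\mathbb{R}^{m\times n}$, $b\in\mathbb{R}^m$, $c\in\mathbb{R}^n$: $\mathrm{val}_{\mathsf{LP}}(A,b,c) := \max\{c^{\mathsf T}x : Ax\le b,\ x\in[0,1]^n\}$, $\mathrm{val}_{\mathsf{IP}}(A,b,c) := \max\{c^{\mathsf T}x : Ax\le b,\ x\in\{0,1\}^n\}$, $\mathsf{IPGAP}(A,b,c) := \mathrm{val}_{\mathsf{LP}}(A,b,c)-\mathrm{val}_{\mathsf{IP}}(A,b,c)$, with the convention $\mathsf{IPGAP}(A,b,c)=+\infty$ if the integer program is infeasible. For $s\in\mathbb{R}$, $s^-:=\min\{s,0\}$, applied coordinate-wise to vectors. $\log$ is the natural logarithm. Best bound first branch-and-bound: the algorithm maintains a rooted binary tree whose nodes correspond to subproblems obtained from the LP relaxation $\max\{c^{\mathsf T}x: Ax\le b, x\in[0,1]^n\}$ by fixing a subset of the variables to $0$ or $1$ (the root fixes none). At each step it selects, among the unprocessed leaves, one whose LP relaxation value is largest, and processes it: if the LP of the node is infeasible, or its value is at most the value of the best integer solution found so far, the node is pruned; if the optimal basic LP solution found is integral, it is recorded as an integer solution and the node becomes a leaf; otherwise the algorithm picks an arbitrary variable $x_i$ that is fractional in that solution and creates two children, additionally fixing $x_i=0$ and $x_i=1$ respectively. The algorithm stops when no unprocessed leaves remain. The size of the tree is its number of nodes. *)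

(* Defs.v *)
From HB Require Import structures.
From mathcomp Require Import all_boot all_order all_algebra.
From mathcomp Require Import all_classical all_reals all_analysis.

Set Implicit Arguments.
Unset Strict Implicit.
Unset Printing Implicit Defensive.

Import Order.TTheory GRing.Theory Num.Theory.
Import numFieldNormedType.Exports.

Local Open Scope classical_set_scope.
Local Open Scope ring_scope.

Section Programs.
Context {R : realType} {m n : nat}.
Implicit Types (A : 'M[R]_(m, n)) (b : 'cV[R]_m) (c x : 'cV[R]_n).

Definition dotp c x : R := (c^T *m x) 0 0.

Definition lp_feasible A b : set 'cV[R]_n :=
  [set x | (forall i, (A *m x) i 0 <= b i 0) /\
           (forall j, 0 <= x j 0 <= 1)].

Definition integral_vec x : Prop := forall j, x j 0 = 0 \/ x j 0 = 1.

Definition ip_feasible A b : set 'cV[R]_n :=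
  [set x | (forall i, (A *m x) i 0 <= b i 0) /\ integral_vec x].

(* The feasible sets used below are compact, so this supremum is a maximum
   whenever S is nonempty; it is -oo when S is empty. *)
Definition max_value c (S : set 'cV[R]_n) : \bar R :=
  ereal_sup [set (dotp c x)%:E | x in S].

Definition val_LP A b c : \bar R := max_value c (lp_feasible A b).
Definition val_IP A b c : \bar R := max_value c (ip_feasible A b).

Definition IPGAP A b c : \bar R :=
  if `[< ip_feasible A b = set0 >] then +oo%E
  else (val_LP A b c - val_IP A b c)%E.

End Programs.

Definition norm2 {R : realType} {m : nat} (v : 'cV[R]_m) : R :=
  Num.sqrt (\sum_i v i 0 ^+ 2).

Definition neg_part {R : realType} {m : nat} (b : 'cV[R]_m) : 'cV[R]_m :=
  \col_i Num.min (b i 0) 0.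

Section BranchAndBound.
Context {R : realType} {m n : nat}.
Implicit Types (A : 'M[R]_(m, n)) (b : 'cV[R]_m) (c x : 'cV[R]_n).

(* A subproblem: [s j = Some v] fixes x_j to v, [s j = None] leaves x_j free. *)
Definition fixing := {ffun 'I_n -> option bool}.

Definition no_fixing : fixing := [ffun=> None].

Definition fix_var (s : fixing) (i : 'I_n) (v : bool) : fixing :=
  [ffun j => if j == i then Some v else s j].

Definition node_feasible A b (s : fixing) : set 'cV[R]_n :=
  [set x | lp_feasible A b x /\
           (forall j v, s j = Some v -> x j 0 = v%:R)].

Definition node_value A b c (s : fixing) : \bar R :=
  max_value c (node_feasible A b s).

(* The gradients of the constraints tight at x (zero rows for the others). The
   equations x_j = v of a node need no rows of their own: they make a bound on
   x_j tight, with the same gradient up to sign. *)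
Definition tight_rows A b x : 'M[R]_(m + n, n) :=
  col_mx
    (\matrix_(i, j) if (A *m x) i 0 == b i 0 then A i j else 0)
    (\matrix_(i, j)
       if (x i 0 == 0) || (x i 0 == 1) then (i == j)%:R else 0).

(* n linearly independent tight constraints *)
Definition basic A b x : Prop := \rank (tight_rows A b x) = n.

Definition optimal_basic A b c (s : fixing) x : Prop :=
  [/\ node_feasible A b s x,
      (forall y, node_feasible A b s y -> dotp c y <= dotp c x)
    & basic A b x].

(* [Pending] is an unprocessed leaf and [Fathomed] a processed one; in
   [Branch i T0 T1], T0 is the subtree of the child x_i = 0 and T1 that of the
   child x_i = 1. The subproblem of a node is read off the path to the root. *)
Inductive bb_tree : Type :=
| Pending
| Fathomed
| Branch of 'I_n & bb_tree & bb_tree.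

Fixpoint bb_size (T : bb_tree) : nat :=
  if T is Branch _ T0 T1 then (bb_size T0 + bb_size T1).+1 else 1%N.

(* Here and in [replace_pending], s is the subproblem at the root of T. *)
Fixpoint pending_leaves (s : fixing) (T : bb_tree) : seq fixing :=
  match T with
  | Pending => [:: s]
  | Fathomed => [::]
  | Branch i T0 T1 =>
      pending_leaves (fix_var s i false) T0 ++
      pending_leaves (fix_var s i true) T1
  end.

(* [replace_pending s T q U T']: T' is T with one pending leaf, whose
   subproblem is q, replaced by U. *)
Inductive replace_pending :
  fixing -> bb_tree -> fixing -> bb_tree -> bb_tree -> Prop :=
| ReplaceHere s U : replace_pending s Pending s U U
| ReplaceLeft s i T0 T1 q U T0' :
    replace_pending (fix_var s i false) T0 q U T0' ->
    replace_pending s (Branch i T0 T1) q U (Branch i T0' T1)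
| ReplaceRight s i T0 T1 q U T1' :
    replace_pending (fix_var s i true) T1 q U T1' ->
    replace_pending s (Branch i T0 T1) q U (Branch i T0 T1').

Definition best_bound A b c (T : bb_tree) (q : fixing) : Prop :=
  forall q', q' \in pending_leaves no_fixing T ->
    (node_value A b c q' <= node_value A b c q)%E.

Definition prunable A b c (inc : \bar R) (q : fixing) : Prop :=
  node_feasible A b q = set0 \/ (node_value A b c q <= inc)%E.

(* A state is the current tree with the value of the best integer solution
   found so far (-oo if there is none). All choices the algorithm leaves open
   (ties between leaves, the optimal basic solution, the branching variable)
   are nondeterministic. *)
Inductive bb_step A b c :
  bb_tree * \bar R -> bb_tree * \bar R -> Prop :=
| StepPrune T inc q T' :
    best_bound A b c T q ->
    prunable A b c inc q ->
    replace_pending no_fixing T q Fathomed T' ->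
    bb_step A b c (T, inc) (T', inc)
| StepIntegral T inc q T' x :
    best_bound A b c T q ->
    ~ prunable A b c inc q ->
    optimal_basic A b c q x ->
    integral_vec x ->
    replace_pending no_fixing T q Fathomed T' ->
    bb_step A b c (T, inc) (T', maxe inc (dotp c x)%:E)
| StepBranch T inc q T' x i :
    best_bound A b c T q ->
    ~ prunable A b c inc q ->
    optimal_basic A b c q x ->
    0 < x i 0 < 1 ->
    replace_pending no_fixing T q (Branch i Pending Pending) T' ->
    bb_step A b c (T, inc) (T', inc).

Inductive bb_reachable A b c : bb_tree * \bar R -> Prop :=
| ReachStart : bb_reachable A b c (Pending, -oo%E)
| ReachStep S S' :
    bb_reachable A b c S -> bb_step A b c S S' -> bb_reachable A b c S'.

Definition is_bb_tree A b c (T : bb_tree) : Prop :=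
  (exists inc, bb_reachable A b c (T, inc)) /\
  pending_leaves no_fixing T = [::].

End BranchAndBound.

Arguments bb_tree n : clear implicits.

Section Probability.
Context {d : measure_display} {T : measurableType d} {R : realType}.
Variable P : probability T R.

Definition mutually_independent (I : finType) (X : I -> {RV P >-> R}) : Prop :=
  forall (J : {set I}) (B : I -> set R),
    (forall i, measurable (B i)) ->
    P [set w | forall i, i \in J -> B i (X i w)] =
    (\prod_(i in J) P (X i @^-1` B i))%E.

(* [normal_prob 0 1] is a measure only on measurable sets. *)
Definition standard_normal (X : {RV P >-> R}) : Prop :=
  forall B : set R, measurable B -> distribution P X B = normal_prob 0 1 B.

(* All entries of A and c together form one i.i.d. family. *)
Definition iid_standard_normal {m n : nat}
    (A : 'I_m -> 'I_n -> {RV P >-> R}) (c : 'I_n -> {RV P >-> R}) : Prop :=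
  let X (k : 'I_m * 'I_n + 'I_n) :=
    match k with inl ij => A ij.1 ij.2 | inr j => c j end in
  mutually_independent X /\ forall k, standard_normal (X k).

Definition random_mx {m n : nat} (A : 'I_m -> 'I_n -> {RV P >-> R}) (w : T) :
  'M[R]_(m, n) := \matrix_(i, j) A i j w.

Definition random_vec {n : nat} (c : 'I_n -> {RV P >-> R}) (w : T) :
  'cV[R]_n := \col_j c j w.

(* [Q] has probability at least [p]. The measure P carries no information on
   non-measurable sets, hence the measurable event E; for measurable Q this is
   [p%:E <= P Q]. *)
Definition with_prob_at_least (p : R) (Q : set T) : Prop :=
  exists E : set T, [/\ measurable E, E `<=` Q & (p%:E <= P E)%E].

End Probability.

Section Regime.
Context {R : realType}.

(* m^2.5 (m + log n)^2 *)
Definition gap_rate (m n : nat) : R :=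
  m%:R `^ (5 / 2) * (m%:R + ln n%:R) ^+ 2.

Definition admissible (C : R) (m n : nat) (b : 'cV[R]_m) : Prop :=
  [/\ (0 < m)%N, C * m%:R `^ (9 / 2) <= n%:R & norm2 (neg_part b) <= n%:R / 10].

Definition gap_tail_property (C : R) : Prop :=
  forall (m n : nat) (b : 'cV[R]_m), admissible C n b ->
  forall (d : measure_display) (T : measurableType d) (P : probability T R)
    (A : 'I_m -> 'I_n -> {RV P >-> R}) (c : 'I_n -> {RV P >-> R}),
  iid_standard_normal A c ->
  forall t : R, 1 <= t <= n%:R / (C * gap_rate m n) ->
  (P [set w | ((10 ^+ 15 * t * (gap_rate m n / n%:R))%:E <=
               IPGAP (random_mx A w) b (random_vec c w))%E] <=
   (4 * (1 - 25^-1) `^ t + n%:R ^- 7)%:E)%E.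

End Regime.

(* Main.v *)
(** A branched node of a best bound first tree has an LP optimum x of value at
    least val_IP, hence within the integrality gap g of the root value. Take
    an optimal vertex l of the dual of the root LP and the reduced costs
    r_j = c_j - l A_j. By complementary slackness, x satisfies
    sum_j |r_j| |x_j - [r_j > 0]| <= g, and rounding the fractional entries of x
    towards [r_j > 0] gives a 0/1 point satisfying the same inequality and
    the same fixings. Nodes of equal depth have incompatible fixings, so a tree
    has at most n branched nodes per such 0/1 point, and by an exponential
    Markov bound there are at most exp (th g) prod_j (1 + exp (- th |r_j|)) such
    points.

    The vertex l is determined by m of the m + n equations l_i = 0, r_j = 0.
    For a fixed choice of equations, l does not involve the remaining c_j, so
    given everything else each remaining r_j has density at most 1/2, and the
    product over these j has expectation at most (1 + 1/th)^n. Summing over the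
    (m + n)^m choices, Markov's inequality and th = sqrt (n / g) bound the tree
    size by n^O(m) exp (2 sqrt (n g)). *)

Require Import Defs.
From HB Require Import structures.
From mathcomp Require Import all_boot all_order all_algebra.
From mathcomp Require Import all_classical all_reals all_analysis.
From mathcomp Require Import measurable_realfun.
From mathcomp Require Import ring lra.

Set Implicit Arguments.
Unset Strict Implicit.
Unset Printing Implicit Defensive.

Import Order.TTheory GRing.Theory Num.Theory.
Import numFieldNormedType.Exports.

Local Open Scope classical_set_scope.
Local Open Scope ring_scope.

(** * Farkas' lemma and the optimal dual vertex *)

Lemma mulmx_entryBr (R : comPzRingType) (n : nat) (u : 'rV[R]_n)
    (x y : 'cV[R]_n) (a : R) :
  (u *m (x - a *: y)) 0 0 = (u *m x) 0 0 - a * (u *m y) 0 0.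
Proof. by rewrite mulmxBr -scalemxAr [LHS]mxE; congr (_ + _); rewrite 2!mxE. Qed.

Lemma mulmx_entryBl (R : comPzRingType) (n : nat) (u v : 'rV[R]_n)
    (x : 'cV[R]_n) (a : R) :
  ((u - a *: v) *m x) 0 0 = (u *m x) 0 0 - a * (v *m x) 0 0.
Proof. by rewrite mulmxBl -scalemxAl [LHS]mxE; congr (_ + _); rewrite 2!mxE. Qed.

(** Induction on the generators. If the separator [d] for the tail is positive on [g k], the
    induction hypothesis is used again on projections along [g k]: a conic combination lifts by
    adding a multiple of [g k], a separator by making it orthogonal to [g k]. *)
Lemma farkas (R : realFieldType) (n : nat) (I : eqType) (g : I -> 'rV[R]_n)
    (s : seq I) (c : 'rV[R]_n) : uniq s ->
  (exists2 a : I -> R, (forall i, 0 <= a i) & c = \sum_(i <- s) a i *: g i) \/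
  (exists2 d : 'cV[R]_n,
     {in s, forall i, (g i *m d) 0 0 <= 0} & 0 < (c *m d) 0 0).
Proof.
elim: s g c => [|k s IH] g c /=.
  have [->|c0] := eqVneq c 0.
    by left; exists (fun=> 0) => //; rewrite big_nil.
  right; exists c^T => //; rewrite mxE.
  have c2 i : 0 <= c 0 i * c^T i 0 by rewrite mxE -expr2 sqr_ge0.
  rewrite lt_def sumr_ge0 // andbT; apply: contra c0 => /eqP/psumr_eq0P h.
  apply/eqP/rowP => i; rewrite mxE; apply/eqP; rewrite -sqrf_eq0 expr2.
  by have := h (fun i _ => c2 i) i isT; rewrite mxE => ->.
case/andP => ks us.
have [[a a0 ca]|[d gd cd]] := IH g c us.
  left; exists (fun i => if i == k then 0 else a i) => [i|]; first by case: eqP.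
  rewrite big_cons eqxx scale0r add0r ca.
  by apply: eq_big_seq => i si; case: eqP => // ik; rewrite -ik si in ks.
have [gkd|gkd] := lerP ((g k *m d) 0 0) 0.
  by right; exists d => // i; rewrite inE => /predU1P[->|/gd].
(* Project along [g k] onto the hyperplane orthogonal to [d]. *)
set p := fun v : 'rV[R]_n => (v *m d) 0 0 / (g k *m d) 0 0.
have [[a a0 ca]|[e ge ce]] := IH (fun i => g i - p (g i) *: g k) (c - p c *: g k) us.
  (* The coefficient of [g k] is nonnegative since [p c > 0] while [p (g i) <= 0] on [s]. *)
  left; exists (fun i => if i == k then p c - \sum_(i <- s) a i * p (g i) else a i).
    move=> i; case: eqP => // _; rewrite subr_ge0.
    apply: (@le_trans _ _ 0); last by rewrite divr_ge0 // ltW.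
    rewrite big_seq; apply: sumr_le0 => j js; rewrite mulr_ge0_le0 //.
    by rewrite /p pmulr_lle0 ?invr_gt0 // gd.
  rewrite big_cons eqxx scalerBl -addrA addrC -[c in LHS](subrK (p c *: g k)).
  congr (_ + _); rewrite ca addrC scaler_suml -sumrB.
  apply: eq_big_seq => i si; case: eqP => [ik|_]; first by rewrite -ik si in ks.
  by rewrite scalerBr scalerA.
have sw (x y z : R) : x / y * z = z / y * x by rewrite mulrAC [RHS]mulrAC (mulrC x).
right; exists (e - ((g k *m e) 0 0 / (g k *m d) 0 0) *: d).
  move=> i; rewrite inE => /predU1P[->|/ge].
    by rewrite mulmx_entryBr divfK ?subrr // gt_eqF.
  by rewrite mulmx_entryBr mulmx_entryBl /p sw.
by move: ce; rewrite mulmx_entryBr mulmx_entryBl /p sw.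
Qed.

(** Moving the coefficients along a linear dependency until the first one vanishes drops an index;
    this is repeated until the generators are independent. *)
Lemma caratheodory (R : realFieldType) (V : lmodType R) (I : finType)
    (g : I -> V) (S : {set I}) (a : I -> R) (c : V) :
  {in S, forall i, 0 <= a i} -> c = \sum_(i in S) a i *: g i ->
  exists (S' : {set I}) (a' : I -> R),
    [/\ S' \subset S, {in S', forall i, 0 <= a' i},
        c = \sum_(i in S') a' i *: g i
      & forall q : I -> R, \sum_(i in S') q i *: g i = 0 ->
          {in S', forall i, q i = 0}].
Proof.
elim/ltn_ind: {S}#|S| {-2}S (erefl #|S|) a => N IH S SN a a0 ca.
have [free|/existsNP[q /not_implyP[q0 /existsNP[i0 /not_implyP[i0S qi0]]]]] :=
  pselect (forall q : I -> R, \sum_(i in S) q i *: g i = 0 ->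
             {in S, forall i, q i = 0}).
  by exists S, a.
wlog qpos : q q0 qi0 / 0 < q i0.
  move=> W; have [|qn|/esym//] := ltgtP 0 (q i0); first exact: W.
  apply: (W (fun i => - q i)); last by rewrite oppr_gt0.
    by under eq_bigr do rewrite scaleNr; rewrite sumrN q0 oppr0.
  by move=> /eqP; rewrite oppr_eq0 => /eqP.
have i0P : (i0 \in S) && (0 < q i0) by rewrite i0S.
(* Ratio test: the index minimizing [a i / q i] over [q i > 0] is the first to reach zero. *)
case: (@Order.TotalTheory.arg_minP _ _ _ i0
  (fun i => (i \in S) && (0 < q i)) (fun i => a i / q i) i0P) => k.
case/andP => kS qk kmin.
pose a' i := a i - a k / q k * q i.
have a'k : a' k = 0 by rewrite /a' divfK ?subrr // gt_eqF.
have [|||S' [b [S'S b0 cb fr]]] := IH #|S :\ k| _ (S :\ k) erefl a'.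
- by rewrite -SN [X in (_ < X)%N](cardsD1 k) kS.
- move=> i; rewrite !inE => /andP[ik iS]; rewrite /a' subr_ge0.
  have [qi|qi] := ltrP 0 (q i).
    by rewrite -ler_pdivlMr //; apply: kmin; rewrite iS.
  apply: (@le_trans _ _ 0); last exact: a0.
  by rewrite mulr_ge0_le0 // divr_ge0 ?a0 // ltW.
- have -> : c = \sum_(i in S) a' i *: g i.
    under eq_bigr do rewrite scalerBl -scalerA.
    by rewrite sumrB -scaler_sumr q0 scaler0 subr0.
  by rewrite (big_setD1 k) //= a'k scale0r add0r.
- exists S', b; split => //; exact: (fintype.subset_trans S'S (finset.subsetDl _ _)).
Qed.

Section DualCertificate.
Context {R : realType} {m n : nat}.
Implicit Types (A : 'M[R]_(m, n)) (b : 'cV[R]_m) (c x y : 'cV[R]_n).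
Implicit Types (f : {ffun 'I_m -> 'I_m + 'I_n}).

(* The system of m equations in the dual multipliers [l : 'rV_m] selected by f:
   [inl i] stands for [l_i = 0], and [inr j] for [l A_j = c_j]. *)
Definition sel_mx A f : 'M[R]_m :=
  \matrix_(i, k) match f k with inl l => (i == l)%:R | inr j => A i j end.

Definition sel_rhs c f : 'rV[R]_m :=
  \row_k match f k with inl _ => 0 | inr j => c j 0 end.

(* Cramer's rule; the value is junk if [sel_mx A f] is singular. *)
Definition multiplier A c f : 'rV[R]_m :=
  (\det (sel_mx A f))^-1 *: (sel_rhs c f *m \adj (sel_mx A f)).

Definition reduced_cost A c (l : 'rV[R]_m) (j : 'I_n) : R :=
  c j 0 - (l *m A) 0 j.

Lemma multiplier_uniq A c f (l : 'rV[R]_m) :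
  sel_mx A f \in unitmx -> l *m sel_mx A f = sel_rhs c f ->
  multiplier A c f = l.
Proof.
move=> U e; rewrite /multiplier -e -mulmxA mul_mx_adj mul_mx_scalar scalerA.
by rewrite mulVr ?scale1r.
Qed.

(** By the last hypothesis, the equations [l_i = 0] off [I] and [r_j = 0] off [J] have full rank, so
    m of them form an invertible system; [f] selects these. *)
Lemma multiplier_exists A c (l : 'rV[R]_m) (I : {set 'I_m}) (J : {set 'I_n}) :
  (forall i, i \notin I -> l 0 i = 0) ->
  (forall j, j \notin J -> reduced_cost A c l j = 0) ->
  (forall v : 'cV[R]_m, (forall i, i \notin I -> v i 0 = 0) ->
     (forall j, j \notin J -> \sum_i v i 0 * A i j = 0) -> v = 0) ->
  exists f, multiplier A c f = l.
Proof.
move=> lI lJ nondeg.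
pose W : 'M[R]_(m + n, m) := \matrix_(r < m + n, i < m)
  match fintype.split r with
  | inl i' => if i' \in I then 0 else (i == i')%:R
  | inr j => if j \in J then 0 else A i j end.
have sL i : fintype.split (lshift n i) = inl i := unsplitK (inl i).
have sR j : fintype.split (rshift m j) = inr j := unsplitK (inr j).
have Wfull : row_full W.
  rewrite /row_full -mxrank_tr -/(row_free W^T) -kermx_eq0.
  apply/rowV0P => v; rewrite sub_kermx => /eqP/rowP vW.
  have -> : v = v^T^T by rewrite trmxK.
  rewrite (nondeg v^T) ?trmx0 // => [i iI|j jJ].
    have := vW (lshift n i); rewrite !mxE => <-.
    rewrite (bigD1 i) //= big1 => [|k ki].
      by rewrite !mxE ?sL ?sR (negPf iI) eqxx mulr1 addr0.
    by rewrite !mxE ?sL ?sR (negPf iI) (negPf ki) mulr0.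
  have := vW (rshift m j); rewrite !mxE => h; rewrite -[RHS]h.
  by apply: eq_bigr => k _; rewrite !mxE ?sL ?sR (negPf jJ).
have [h U] : exists h : 'I_m -> 'I_(m + n), rowsub h W \in unitmx.
  by exists (fullrankfun Wfull); exact: fullrowsub_unit.
(* An invertible submatrix contains no zeroed row, so each selected row is a genuine equation. *)
have hP k : (exists2 i, i \notin I & h k = lshift n i) \/
            (exists2 j, j \notin J & h k = rshift m j).
  have r0 : row (h k) W != 0.
    apply: contraTneq U => r0; rewrite unitmxE (expand_det_row _ k).
    rewrite big1 ?unitr0 // => i _.
    by move/rowP/(_ i): r0; rewrite !mxE => ->; rewrite mul0r.
  rewrite -[h k]splitK in r0 *; case: (fintype.split (h k)) r0 => [i|j] /= r0.
    left; exists i => //; apply: contraNN r0 => iI; apply/eqP/rowP => i'.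
    by rewrite !mxE sL iI.
  right; exists j => //; apply: contraNN r0 => jJ; apply/eqP/rowP => i'.
  by rewrite !mxE sR jJ.
exists [ffun k => fintype.split (h k)].
have E : (rowsub h W)^T = sel_mx A [ffun k => fintype.split (h k)].
  apply/matrixP => i k; rewrite !mxE ffunE.
  by have [[i' iI ->]|[j jJ ->]] := hP k; rewrite ?sL ?sR ?(negPf iI) ?(negPf jJ).
apply: multiplier_uniq; first by rewrite -E unitmx_tr.
rewrite -E; apply/rowP => k; rewrite !mxE ffunE.
have [[i iI hk]|[j jJ hk]] := hP k; rewrite hk ?sL ?sR.
  rewrite big1 // => i' _; rewrite !mxE hk sL (negPf iI).
  by case: eqP => [->|_]; rewrite ?mulr0 // lI // mul0r.
have /eqP := lJ j jJ; rewrite /reduced_cost subr_eq0 => /eqP ->.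
by rewrite !mxE; apply: eq_bigr => i _; rewrite !mxE hk sR (negPf jJ).
Qed.
End DualCertificate.

(** Read [s] as slacks and [v] as rates of change. The inverse of one plus the sum of all ratios
    [|v i| / s i] is a short enough step. *)
Lemma small_step (R : realFieldType) (I : finType) (v s : I -> R) :
  (forall i, 0 <= s i) -> (forall i, s i = 0 -> v i <= 0) ->
  exists2 e, 0 < e & forall i, e * v i <= s i.
Proof.
move=> s0 v0; set t := 1 + \sum_i `|v i| / s i.
have n0 i : 0 <= `|v i| / s i by rewrite divr_ge0.
have t0 : 0 < t by rewrite ltr_pwDl // sumr_ge0.
exists t^-1; first by rewrite invr_gt0.
move=> i; rewrite ler_pdivrMl //.
have [si|si] := eqVneq (s i) 0; first by rewrite si mulr0 v0.
have {}si : 0 < s i by rewrite lt_def si s0.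
rewrite -ler_pdivrMr // /t (bigD1 i) //= addrCA.
apply: (@le_trans _ _ (`|v i| / s i)).
  by rewrite ler_pM2r ?invr_gt0 // ler_norm.
by rewrite lerDl addr_ge0 // sumr_ge0.
Qed.

Section OptimalDual.
Context {R : realType} {m n : nat}.
Implicit Types (A : 'M[R]_(m, n)) (b : 'cV[R]_m) (c x y : 'cV[R]_n).

Lemma dotpE c x : dotp c x = \sum_j c j 0 * x j 0.
Proof. by rewrite /dotp mxE; apply: eq_bigr => j _; rewrite mxE. Qed.

(* The gradients of the tight constraints at x, oriented outwards. *)
Definition tight A b x : {set 'I_m + 'I_n} :=
  [set k | match k with
           | inl i => (A *m x) i 0 == b i 0
           | inr j => (x j 0 == 0) || (x j 0 == 1) end].

Definition outward x j : R := if x j 0 == 0 then -1 else 1.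

Definition gradient A x (k : 'I_m + 'I_n) : 'rV[R]_n :=
  match k with
  | inl i => row i A
  | inr j => outward x j *: delta_mx 0 j
  end.

Lemma gradient_sum A x (S : {set 'I_m + 'I_n}) (a : 'I_m + 'I_n -> R) j :
  (\sum_(k in S) a k *: gradient A x k) 0 j =
  \sum_(i | inl i \in S) a (inl i) * A i j +
  (if inr j \in S then a (inr j) * outward x j else 0).
Proof.
rewrite summxE big_sumType /=; congr (_ + _).
  by apply: eq_bigr => i _; rewrite !mxE.
case: ifP => jS.
  rewrite (bigD1 j) //= big1 => [|k /andP[_ kj]].
    by rewrite !mxE !eqxx mulr1 addr0.
  by rewrite !mxE [_ == k]eq_sym (negPf kj) !mulr0.
rewrite big1 // => k kS; rewrite !mxE [j == k](_ : _ = false) ?mulr0 //.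
by apply: contraTF kS => /eqP <-; rewrite jS.
Qed.

(** Otherwise Farkas' lemma gives a direction that increases the objective and violates no tight
    constraint to first order; a small step along it contradicts optimality. *)
Lemma tight_cone A b c x : lp_feasible A b x ->
  (forall y, lp_feasible A b y -> dotp c y <= dotp c x) ->
  exists2 a : 'I_m + 'I_n -> R, (forall k, 0 <= a k) &
    c^T = \sum_(k in tight A b x) a k *: gradient A x k.
Proof.
move=> [Ax x01] opt.
have [[a a0 ca]|[d gd cd]] := farkas (gradient A x) c^T (enum_uniq (mem (tight A b x))).
  by exists a => //; rewrite ca big_enum.
pose v (k : 'I_m + ('I_n + 'I_n)) := match k with
  | inl i => (A *m d) i 0 | inr (inl j) => - d j 0 | inr (inr j) => d j 0 end.
pose s (k : 'I_m + ('I_n + 'I_n)) := match k with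
  | inl i => b i 0 - (A *m x) i 0
  | inr (inl j) => x j 0 | inr (inr j) => 1 - x j 0 end.
have gj j : inr j \in tight A b x -> outward x j * d j 0 <= 0.
  move=> jt; have := gd (inr j); rewrite mem_enum => /(_ jt).
  rewrite /gradient -scalemxAl mxE -rowE [X in _ * X <= _]mxE.
  by rewrite /outward.
have [||e e0 he] := @small_step _ _ v s.
- case=> [i|[j|j]] /=; first by rewrite subr_ge0.
    by have /andP[] := x01 j.
  by rewrite subr_ge0; have /andP[] := x01 j.
- case=> [i|[j|j]] /=.
  + move/eqP; rewrite subr_eq0 eq_sym => t.
    have := gd (inl i); rewrite mem_enum inE => /(_ t).
    by rewrite /gradient -row_mul mxE.
  + move=> xj; have := gj j; rewrite inE xj eqxx /= => /(_ isT).
    by rewrite /outward xj eqxx mulN1r.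
  + move/eqP; rewrite subr_eq0 eq_sym => /eqP xj.
    by have := gj j; rewrite inE xj eqxx orbT /outward xj oner_eq0 mul1r; apply.
have /opt : lp_feasible A b (x + e *: d).
  split => [i|j]; rewrite ?mulmxDr -?scalemxAr.
    rewrite [leLHS]mxE [X in _ + X]mxE addrC -lerBrDr.
    exact: (he (inl i)).
  have -> : (x + e *: d) j 0 = x j 0 + e * d j 0 by rewrite 2!mxE.
  have := he (inr (inl j)); have := he (inr (inr j)); rewrite /= mulrN.
  by move=> h1 h2; apply/andP; split; lra.
rewrite leNgt /dotp mulmxDr -scalemxAr [ltRHS]mxE.
by rewrite ltrDl [X in _ < X]mxE mulr_gt0.
Qed.

(** Write [c] as a conic combination of independent tight gradients. The coefficients of the rows of
    [A] form the dual vertex, those of the bounds are the reduced costs up to sign. The objective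
    loss at [y] is then the sum on the left plus the nonnegative row term [l (A x - A y)]. *)
Lemma dual_certificate A b c x : lp_feasible A b x ->
  (forall y, lp_feasible A b y -> dotp c y <= dotp c x) ->
  exists f, forall y, lp_feasible A b y ->
    \sum_j `|reduced_cost A c (multiplier A c f) j| *
           `|(0 < reduced_cost A c (multiplier A c f) j)%R%:R - y j 0|
    <= dotp c x - dotp c y.
Proof.
move=> fx opt; have [a0 a00 ca0] := tight_cone fx opt.
have [S [a [ST apos ca free]]] :=
  caratheodory (fun k _ => a00 k) ca0.
pose l : 'rV[R]_m := \row_i if inl i \in S then a (inl i) else 0.
have rcE j : reduced_cost A c l j =
    if inr j \in S then a (inr j) * outward x j else 0.
  rewrite /reduced_cost; have -> : c j 0 = c^T 0 j by rewrite mxE.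
  rewrite ca gradient_sum [X in _ - X]mxE addrC.
  rewrite [X in - X](_ : _ = \sum_(i | inl i \in S) a (inl i) * A i j) ?addrA ?addNr ?add0r //.
  rewrite [RHS]big_mkcond; apply: eq_bigr => i _; rewrite mxE.
  by case: ifP; rewrite ?mul0r.
have [|||f fl] := @multiplier_exists _ m n A c l [set i | inl i \in S]
    [set j | inr j \in S].
- by move=> i; rewrite inE mxE => /negPf ->.
- by move=> j; rewrite inE rcE => /negPf ->.
- move=> v vS vA.
  (* A nonzero [v] satisfying the homogeneous equations would extend to a dependency [q] among the
     chosen gradients. *)
  pose q (k : 'I_m + 'I_n) := match k with
    | inl i => v i 0 | inr j => - (\sum_i v i 0 * A i j) * outward x j end.
  have sumv j : \sum_(i | inl i \in S) v i 0 * A i j = \sum_i v i 0 * A i j.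
    rewrite [LHS]big_mkcond; apply: eq_bigr => i _; case: ifPn => // iS.
    by rewrite vS ?mul0r // inE.
  have /free q0 : \sum_(k in S) q k *: gradient A x k = 0.
    apply/rowP => j; rewrite gradient_sum /= sumv [RHS]mxE; case: ifPn => jS.
      rewrite -mulrA (_ : outward x j * outward x j = 1) ?mulr1 ?addrN //.
      by rewrite /outward; case: ifP; rewrite ?mulrNN mulr1.
    by rewrite addr0 vA // inE.
  apply/colP => i; rewrite mxE.
  have [iS|iS] := boolP (inl i \in S); first exact: (q0 (inl i)).
  by rewrite vS // inE.
exists f => y [Ay y01]; rewrite fl; have [Ax _] := fx.
have dE z : dotp c z = \sum_i l 0 i * (A *m z) i 0 + \sum_j reduced_cost A c l j * z j 0.
  have -> : \sum_i l 0 i * (A *m z) i 0 = \sum_j (l *m A) 0 j * z j 0.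
    have -> : \sum_i l 0 i * (A *m z) i 0 = (l *m (A *m z)) 0 0 by rewrite [RHS]mxE.
    by rewrite mulmxA mxE.
  rewrite dotpE -big_split /=; apply: eq_bigr => j _.
  by rewrite -mulrDl /reduced_cost addrC subrK.
rewrite !dE opprD addrACA -!sumrB.
(* Complementary slackness: where the reduced cost is nonzero, [x] sits at the bound favoured by its
   sign. *)
have -> : \sum_j (reduced_cost A c l j * x j 0 - reduced_cost A c l j * y j 0) =
    \sum_j `|reduced_cost A c l j| * `|(0 < reduced_cost A c l j)%R%:R - y j 0|.
  apply: eq_bigr => j _; rewrite -mulrBr rcE; case: ifPn => jS; last first.
    by rewrite normr0 !mul0r.
  have /andP[y0 y1] := y01 j; have aj := apos _ jS.
  have := fintype.subsetP ST _ jS; rewrite inE /outward; case: eqP => [-> _|_ /eqP ->].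
    rewrite mulrN1 normrN oppr_gt0 ltNge aj /= !sub0r normrN !ger0_norm //.
    by rewrite mulrNN.
  rewrite mulr1 (ger0_norm aj).
  have [->|an] := eqVneq (a (inr j)) 0; first by rewrite !mul0r.
  by rewrite lt_def an aj /= ger0_norm // subr_ge0.
rewrite lerDr sumr_ge0 // => i _; rewrite -mulrBr mxE; case: ifPn => iS.
  rewrite mulr_ge0 ?apos // subr_ge0.
  have := fintype.subsetP ST _ iS; rewrite inE => /eqP ->; exact: Ay.
by rewrite mul0r.
Qed.

End OptimalDual.

(** * Size of branch-and-bound trees *)

Section Trees.
Context {n : nat}.
Implicit Types (s q : @fixing n) (T U : bb_tree n) (i j : 'I_n).
Implicit Types (z : {ffun 'I_n -> bool}).

Fixpoint branches T : nat :=
  if T is Branch _ T0 T1 then (branches T0 + branches T1).+1 else 0%N.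

Lemma bb_size_branches T : bb_size T = (branches T).*2.+1.
Proof. by elim: T => //= i T0 -> T1 ->; rewrite doubleS doubleD addSn addnS. Qed.

Fixpoint all_branches (Q : @fixing n -> 'I_n -> Prop) s T : Prop :=
  if T is Branch i T0 T1 then
    [/\ Q s i, all_branches Q (fix_var s i false) T0
      & all_branches Q (fix_var s i true) T1]
  else True.

Lemma all_branches_impl (Q Q' : @fixing n -> 'I_n -> Prop) s T :
  (forall s i, Q s i -> Q' s i) -> all_branches Q s T -> all_branches Q' s T.
Proof. by move=> QQ'; elim: T s => //= i T0 IH0 T1 IH1 s [/QQ' ? /IH0 ? /IH1 ?]. Qed.

Lemma replace_pending_kept s T q U T' q' : replace_pending s T q U T' ->
  q' \in pending_leaves s T -> q' = q \/ q' \in pending_leaves s T'.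
Proof.
elim=> {s T q U T'} [s U|s i T0 T1 q U T' _ IH|s i T0 T1 q U T' _ IH] /=.
- by rewrite inE => /eqP; left.
- rewrite !mem_cat => /orP[/IH[->|->]|->]; rewrite ?orbT; by [left|right].
- rewrite !mem_cat => /orP[->|/IH[->|->]]; rewrite ?orbT; by [left|right].
Qed.

Lemma replace_pending_new s T q U T' q' : replace_pending s T q U T' ->
  q' \in pending_leaves q U -> q' \in pending_leaves s T'.
Proof.
elim=> {s T q U T'} [s U|s i T0 T1 q U T' _ IH|s i T0 T1 q U T' _ IH] //=.
- by rewrite mem_cat => /IH ->.
- by rewrite mem_cat => /IH ->; rewrite orbT.
Qed.

Lemma replace_pending_all Q s T q U T' : replace_pending s T q U T' ->
  all_branches Q s T -> all_branches Q q U -> all_branches Q s T'.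
Proof.
elim=> {s T q U T'} [s U|s i T0 T1 q U T' _ IH|s i T0 T1 q U T' _ IH] //=.
- by move=> [? /IH + ?] => /[apply] ?.
- by move=> [? ? /IH] => /[apply] ?.
Qed.

Definition consistent z s : bool :=
  [forall j, if s j is Some v then z j == v else true].

Lemma consistentP z s :
  reflect (forall j v, s j = Some v -> z j = v) (consistent z s).
Proof.
apply: (iffP forallP) => [h j v sj|h j]; first by have := h j; rewrite sj => /eqP.
by case: (s j) (h j) => // v /(_ v erefl) ->.
Qed.

Lemma consistent_fix_var z s i v : s i = None ->
  consistent z (fix_var s i v) = consistent z s && (z i == v).
Proof.
move=> si; apply/consistentP/andP => [h|[/consistentP h /eqP zi] j w].
  split; last by rewrite (h i v) // ffunE eqxx.
  apply/consistentP => j w sj; apply: h; rewrite ffunE.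
  by case: eqP sj => // ->; rewrite si.
by rewrite ffunE; case: eqP => [-> [<-]|_ /h].
Qed.

(** Branching on a free variable uses up one free variable and splits the consistent points of [Z]
    into two disjoint classes. The branched node itself is paid for by a point of [Z] consistent
    with it. *)
Lemma branches_le (Z : {set {ffun 'I_n -> bool}}) s T :
  all_branches (fun s i => s i = None /\ exists2 z, z \in Z & consistent z s) s T ->
  (branches T <= #|[set j | s j == None]%SET| * #|[set z in Z | consistent z s]%SET|)%N.
Proof.
elim: T s => //= i T0 IH0 T1 IH1 s [[si [z zZ zs]] /IH0 b0 /IH1 b1].
have free v : #|[set j | s j == None]%SET| = #|[set j | fix_var s i v j == None]%SET|.+1.
  rewrite (cardsD1 i) inE si eqxx add1n; congr (_.+1); apply: eq_card => j.
  by rewrite !inE ffunE; case: eqP.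
have split_i : #|[set z in Z | consistent z s]%SET| =
    (#|[set z in Z | consistent z (fix_var s i false)]%SET| +
     #|[set z in Z | consistent z (fix_var s i true)]%SET|)%N.
  rewrite -(cardsID [set z : {ffun 'I_n -> bool} | ~~ z i]%SET).
  congr (_ + _)%N; apply: eq_card => y; rewrite !inE consistent_fix_var //.
    by case: (y \in Z) (consistent y s) (y i) => [] [] [].
  by case: (y \in Z) (consistent y s) (y i) => [] [] [].
apply: (@leq_trans (#|[set j | fix_var s i false j == None]%SET| *
   #|[set z in Z | consistent z s]%SET|).+1).
  rewrite ltnS split_i mulnDr leq_add //.
  by move: b1; rewrite -(succn_inj (etrans (esym (free false)) (free true))).
rewrite (free false) mulSn -addn1 addnC leq_add2r card_gt0.
by apply/set0Pn; exists z; rewrite inE zZ.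
Qed.

End Trees.

(** * The search invariant and the count of near-greedy points *)

Section Invariant.
Context {R : realType} {m n : nat}.
Implicit Types (A : 'M[R]_(m, n)) (b : 'cV[R]_m) (c x y : 'cV[R]_n).
Implicit Types (s q : @fixing n) (T : bb_tree n).

Lemma le_node_value A b c s y :
  node_feasible A b s y -> ((dotp c y)%:E <= node_value A b c s)%E.
Proof. by move=> ys; apply: ereal_sup_ubound; exists y. Qed.

Lemma node_value_le A b c s x :
  optimal_basic A b c s x -> (node_value A b c s <= (dotp c x)%:E)%E.
Proof.
by move=> [_ opt _]; apply: ub_ereal_sup => _ [y ys <-]; rewrite lee_fin opt.
Qed.

Lemma node_feasible_root A b y : lp_feasible A b y -> node_feasible A b no_fixing y.
Proof. by move=> fy; split=> // j v; rewrite ffunE. Qed.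

Lemma ip_lp_feasible A b y : ip_feasible A b y -> lp_feasible A b y.
Proof. by move=> [Ay y01]; split=> // j; case: (y01 j) => ->; rewrite ?lexx ?ler01. Qed.

Definition sound_branch A b c s (i : 'I_n) : Prop :=
  s i = None /\ exists2 x, optimal_basic A b c s x &
    forall y, ip_feasible A b y -> dotp c y <= dotp c x.

(** No integer point is lost: it stays in a pending leaf unless the incumbent is at least as good.
    Together with best bound selection, this puts the LP value of each branched node above all
    integer points. *)
Lemma bb_invariant A b c (S : bb_tree n * \bar R) : bb_reachable A b c S ->
  (forall y, ip_feasible A b y ->
    (exists2 q, q \in pending_leaves no_fixing S.1 & node_feasible A b q y) \/
    ((dotp c y)%:E <= S.2)%E) /\
  all_branches (sound_branch A b c) no_fixing S.1.
Proof.
elim=> {S} [|S S' _ [live sound] step].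
  split=> //= y /ip_lp_feasible fy; left; exists no_fixing; first exact: mem_head.
  exact: node_feasible_root.
case: step live sound => {S S'} [T inc q T' bb pr rep|T inc q T' x bb np opt ix rep|
  T inc q T' x i bb np opt xi rep] /= live sound; split.
- move=> y fy; have [[q' q'T yq']|] := live y fy; last by right.
  have [qq|q'T'] := replace_pending_kept rep q'T; last by left; exists q'.
  right; subst q'; case: pr => [q0|]; first by rewrite q0 in yq'.
  exact: le_trans (le_node_value _ yq').
- exact: replace_pending_all rep sound _.
- move=> y fy; have [[q' q'T yq']|yi] := live y fy; last first.
    by right; rewrite le_max yi.
  have [qq|q'T'] := replace_pending_kept rep q'T; last by left; exists q'.
  right; subst q'; rewrite le_max [X in _ || X](_ : _ = true) ?orbT //.
  exact: le_trans (le_node_value _ yq') (node_value_le opt).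
- exact: replace_pending_all rep sound _.
- move=> y fy; have [[q' q'T yq']|] := live y fy; last by right.
  have [qq|q'T'] := replace_pending_kept rep q'T; last by left; exists q'.
  left; subst q'; have [fy' yq] := yq'.
  have [_ /(_ i) yi] := fy.
  have {}yi : exists v : bool, y i 0 = v%:R.
    by case: yi => ->; [exists false | exists true].
  have [v yv] := yi; exists (fix_var q i v).
    by apply: replace_pending_new rep _; rewrite !inE; case: v {yv}; rewrite eqxx ?orbT.
  split=> // j w; rewrite ffunE; case: eqP => [-> [<-]//|_]; exact: yq.
- apply: replace_pending_all rep sound _ => /=; split=> //; split.
    have [[_ xq] _ _] := opt; case qi: (q i) => [v|] //.
    by move: xi; rewrite (xq _ _ qi); case: v {qi}; rewrite ltxx ?andbF.
  (* If [y] is in a pending leaf, that leaf has value at most that of [q] by best bound; otherwise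
     [y] is bounded by the incumbent, which [q] beats because it is not prunable. *)
  exists x => // y fy; rewrite -lee_fin; apply: le_trans (node_value_le opt).
  have [[q' q'T yq']|yi] := live y fy.
    exact: le_trans (le_node_value _ yq') (bb _ q'T).
  apply: ltW; apply: le_lt_trans yi _; rewrite ltNge; apply/negP => h.
  by apply: np; right.
Qed.

(* The 0/1 points within reduced cost [g] of the maximizer of the Lagrangian
   with multipliers [l]. *)
Definition near_greedy A c (l : 'rV[R]_m) (g : R) : {set {ffun 'I_n -> bool}} :=
  [set z : {ffun 'I_n -> bool} |
    \sum_j `|reduced_cost A c l j| * (z j != (0 < reduced_cost A c l j))%:R <= g].

(** Every branched node has an optimum within [g] of the root optimum; rounding it yields a
    near-greedy point consistent with the node, so [branches_le] applies. *)
Lemma branches_near_greedy A b c T inc (g : R) : bb_reachable A b c (T, inc) ->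
  (exists2 y, ip_feasible A b y & (val_LP A b c < (g + dotp c y)%:E)%E) ->
  exists f, (branches T <= n * #|near_greedy A c (multiplier A c f) g|)%N.
Proof.
move=> /bb_invariant[_ /= sound] [y fy gy].
case: T sound => [||i T0 T1] sound; try by exists [ffun i => inl i].
(* The root is itself branched, which supplies an optimum [x0] of the root LP. *)
have [[_ [x0 [fx0 opt0 _] _]] _ _] := sound.
have [f fP] := dual_certificate (proj1 fx0) (fun y fy => opt0 y (node_feasible_root fy)).
exists f; set l := multiplier A c f in fP *; set Z := near_greedy _ _ _ _.
have /branches_le : all_branches
    (fun s i => s i = None /\ exists2 z, z \in Z & consistent z s)
    no_fixing (Branch i T0 T1).
  apply: all_branches_impl sound => s k [sk [x [[fx xs] _ _] xopt]]; split=> //.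
  (* Rounding the fractional entries towards the greedy point only brings x
     closer to it, and preserves the fixed entries. *)
  pose z := [ffun j => if x j 0 == 0 then false else if x j 0 == 1 then true
                       else 0 < reduced_cost A c l j].
  exists z; last first.
    apply/consistentP => j v /xs xj; rewrite ffunE xj.
    by case: v {xj}; rewrite ?eqxx // oner_eq0.
  rewrite inE; apply: (@le_trans _ _ (dotp c x0 - dotp c x)).
    apply: le_trans (fP x fx); apply: ler_sum => j _; rewrite ler_wpM2l // ffunE.
    have [->|_] := eqVneq (x j 0) 0.
      by case: (0 < _)%R => /=; rewrite subr0 ?normr1 ?normr0.
    have [->|_] := eqVneq (x j 0) 1; last by rewrite eqxx normr_ge0.
    by case: (0 < _)%R => /=; rewrite ?subrr ?sub0r ?normrN ?normr1 ?normr0.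
  have := xopt y fy; have : dotp c x0 <= g + dotp c y.
    rewrite -lee_fin; apply/ltW/le_lt_trans/gy.
    by apply: ereal_sup_ubound; exists x0 => //; case: fx0.
  lra.
move/leq_trans; apply; apply: leq_mul.
  by rewrite -[X in (_ <= X)%N]card_ord max_card.
by apply: subset_leq_card; apply/fintype.subsetP => z; rewrite inE => /andP[].
Qed.

(** Exponential Markov bound: each counted point contributes at least 1 to a sum over all 0/1
    vectors, and that sum factors over the coordinates. *)
Lemma card_near_greedy A c (l : 'rV[R]_m) (g th : R) : 0 <= th ->
  (#|near_greedy A c l g|)%:R <=
  expR (th * g) * \prod_j (1 + expR (- (th * `|reduced_cost A c l j|))).
Proof.
move=> th0; set w := fun j => `|reduced_cost A c l j|.
pose F j (v : bool) := expR (- (th * (w j * (v != (0 < reduced_cost A c l j))%:R))).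
have -> : \prod_j (1 + expR (- (th * w j))) = \prod_j \sum_(v : bool) F j v.
  apply: eq_bigr => j _; rewrite big_bool /F.
  by case: (0 < _)%R; rewrite /= !mulr0 mulr1 oppr0 expR0 // addrC.
rewrite bigA_distr_bigA /= mulr_sumr -sumr_const.
apply: (@le_trans _ _ (\sum_(z in near_greedy A c l g) expR (th * g) * \prod_i F i (z i))).
  apply: ler_sum => z; rewrite inE => zg.
  rewrite -expR_sum -expRD -[leLHS]expR0 ler_expR sumrN -mulr_sumr.
  by rewrite subr_ge0 ler_wpM2l.
rewrite [leRHS](bigID (mem (near_greedy A c l g))) /= lerDl.
by apply: sumr_ge0 => z _; rewrite mulr_ge0 ?expR_ge0 // prodr_ge0 // => j _; rewrite expR_ge0.
Qed.

End Invariant.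

(** * Measurability of the integrality gap *)

Section Excess.
Context {R : realType} {m n : nat}.
Implicit Types (A : 'M[R]_(m, n)) (b : 'cV[R]_m) (c : 'cV[R]_n) (u : 'rV[R]_n).

(* [t + `|t|] is twice the positive part of t. *)
Definition excess A b c (v : R) u : R :=
  \sum_i (((A *m u^T) i 0 - b i 0) + `|(A *m u^T) i 0 - b i 0|) +
  ((v - dotp c u^T) + `|v - dotp c u^T|).

Definition unit_box : set 'rV[R]_n := [set u : 'rV[R]_n | forall j, u ord0 j \in `[0, 1]].

Lemma dbl_pos_ge0 (t : R) : 0 <= t + `|t|.
Proof. by rewrite -lerBlDl sub0r -normrN ler_norm. Qed.

Lemma dbl_pos_eq0 (t : R) : t + `|t| = 0 -> t <= 0.
Proof. by have := normr_ge0 t; lra. Qed.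

Lemma excess_continuous A b c v : continuous (excess A b c v).
Proof.
have lin (a : 'I_n -> R) : continuous (fun u : 'rV[R]_n => \sum_j a j * u 0 j).
  apply: continuous_big => [|j _]; first exact: add_continuous.
  by move=> u; exact: (cvgM (cvg_cst (a j)) (@coord_continuous R 1 n 0 j u)).
have posc (f : 'rV[R]_n -> R) : continuous f -> continuous (fun u => f u + `|f u|).
  by move=> cf u; exact: (cvgD (cf u) (cvg_norm (cf u))).
have AE i : (fun u : 'rV[R]_n => (A *m u^T) i 0) = (fun u => \sum_j A i j * u 0 j).
  by apply/funext => u; rewrite mxE; apply: eq_bigr => j _; rewrite mxE.
have cE : (fun u : 'rV[R]_n => dotp c u^T) = (fun u => \sum_j c j 0 * u 0 j).
  by apply/funext => u; rewrite dotpE; apply: eq_bigr => j _; rewrite mxE.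
have h1 : continuous (fun u => \sum_i (((A *m u^T) i 0 - b i 0) + `|(A *m u^T) i 0 - b i 0|)).
  apply: continuous_big => [|i _]; first exact: add_continuous.
  apply: (posc (fun u => (A *m u^T) i 0 - b i 0)) => u.
  have := lin (A i) u; rewrite -AE => h.
  exact: (cvgB h (cvg_cst (b i 0))).
have h2 : continuous (fun u => (v - dotp c u^T) + `|v - dotp c u^T|).
  apply: (posc (fun u => v - dotp c u^T)) => u.
  have := lin (fun j => c j 0) u; rewrite -cE => h.
  exact: (cvgB (cvg_cst v) h).
by move=> u; exact: (cvgD (h1 u) (h2 u)).
Qed.

(** A countable dense family in the box, for countable unions of events. Numerators run from 0 to
    [N + 1], so both endpoints occur. *)
Definition grid_point (p : {N : nat & {ffun 'I_n -> 'I_N.+2}}) : 'rV[R]_n :=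
  \row_j ((tagged p j : nat)%:R / (tag p).+1%:R).

Lemma grid_point_box p : unit_box (grid_point p).
Proof.
move=> j; rewrite /= in_itv /= mxE divr_ge0 //=.
by rewrite ler_pdivrMr ?ltr0n // mul1r ler_nat -ltnS ltn_ord.
Qed.

Lemma grid_dense u (e : R) : unit_box u -> 0 < e -> exists p, ball u e (grid_point p).
Proof.
(* Rounding down moves each coordinate by less than the mesh [1 / (N + 1)], which is below [e]. *)
move=> u01 e0; pose N := Num.trunc e^-1.
have u0 j : 0 <= u 0 j by have := u01 j; rewrite /= in_itv => /andP[].
have u1 j : u 0 j <= 1 by have := u01 j; rewrite /= in_itv => /andP[].
have N0 : 0 < N.+1%:R :> R by rewrite ltr0n.
have kN (j : 'I_n) : (Num.trunc (u 0 j * N.+1%:R)%R < N.+2)%N.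
  rewrite ltnS -(ler_nat R); apply: (@le_trans _ _ (u 0 j * N.+1%:R)).
    by have /andP[] := truncn_itv (mulr_ge0 (u0 j) (ltW N0)).
  by rewrite ler_piMl // ltW.
exists (existT _ N [ffun j => Ordinal (kN j)]); split => // i j.
rewrite ord1 mxE /= ffunE /= /ball /=.
have /andP[k1 k2] := truncn_itv (mulr_ge0 (u0 j) (ltW N0)).
have eN : 1 < e * N.+1%:R.
  have /andP[_] := truncn_itv (eqbRL (invr_ge0 e) (ltW e0)).
  by rewrite -ltr_pdivrMl // mulr1.
have -> : u 0 j - (Num.trunc (u 0 j * N.+1%:R))%:R / N.+1%:R =
   (u 0 j * N.+1%:R - (Num.trunc (u 0 j * N.+1%:R))%:R) / N.+1%:R.
  by rewrite mulrBl mulfK // gt_eqF.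
rewrite ger0_norm ?divr_ge0 ?subr_ge0 // ltr_pdivrMr //.
set K := Num.trunc _ in k2 *; have := natr1 K; lra.
Qed.

Lemma excess_ge0 A b c v u : 0 <= excess A b c v u.
Proof. by rewrite addr_ge0 ?dbl_pos_ge0 // sumr_ge0 // => i _; exact: dbl_pos_ge0. Qed.

(** The value reaches [v] exactly when the continuous function [excess] has a zero in the compact
    box, that is, when its infimum over a dense grid is zero. *)
Lemma le_val_LP_grid A b c v : ((v%:E <= val_LP A b c)%E <->
  forall k : nat, exists p, excess A b c v (grid_point p) < k.+1%:R^-1).
Proof.
split=> [vLP k|h].
  have k0 : 0 < k.+1%:R^-1 :> R by rewrite invr_gt0 ltr0n.
  (* The tolerance is halved because [excess] doubles positive parts. *)
  have : ((v - k.+1%:R^-1 / 2)%:E < val_LP A b c)%E.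
    by apply: lt_le_trans vLP; rewrite lte_fin ltrBlDr ltrDl divr_gt0.
  move=> /ereal_sup_gt[_ [y [Ay y01] <-]]; rewrite lte_fin => yv.
  have yk : excess A b c v y^T < k.+1%:R^-1.
    rewrite /excess trmxK big1 => [|i _]; last first.
      by rewrite ler0_norm ?subrr // subr_le0.
    rewrite add0r; move: k0 yv; move: k.+1%:R^-1 (dotp c y) => e p e0 ep.
    by have [t0|t0] := lerP 0 (v - p); [rewrite ger0_norm|rewrite ltr0_norm]; lra.
  have /cvgrPdist_lt/(_ _ (eqbRL (subr_gt0 _ _) yk)) := @excess_continuous A b c v y^T.
  move=> /nbhs_ballP[e /= e0 he].
  have [|p yp] := @grid_dense y^T e _ e0.
    by move=> j; rewrite /= in_itv /= mxE.
  exists p; have := he _ yp; rewrite /= distrC => /(le_lt_trans (ler_norm _)).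
  by rewrite ltrD2r.
have [|||u ubx umin] := @compact_EVT_min _ _ (excess A b c v) unit_box.
- by exists (grid_point (existT _ 0%N [ffun=> ord0])); exact: grid_point_box.
- rewrite /unit_box; apply: (@rV_compact R n (fun=> `[0 : R, 1]%classic)) => _.
  exact: segment_compact.
- by apply: continuous_subspaceT; exact: excess_continuous.
have u0 : excess A b c v u = 0.
  apply/eqP; rewrite eq_le excess_ge0 andbT leNgt; apply/negP => u0.
  (* At this index the tolerance is at most the supposedly positive minimum. *)
  have [p] := h (Num.trunc (excess A b c v u)^-1); apply/negP; rewrite -leNgt.
  apply: (@le_trans _ _ (excess A b c v u)); last first.
    by apply: umin; rewrite inE; exact: grid_point_box.
  rewrite invf_ple ?posrE ?ltr0n // ltW //.
  by have /andP[] := truncn_itv (eqbRL (invr_ge0 _) (ltW u0)).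
move: u0; rewrite /excess => /eqP; rewrite paddr_eq0 ?dbl_pos_ge0 //; last first.
  by rewrite sumr_ge0 // => i _; exact: dbl_pos_ge0.
move=> /andP[/eqP/psumr_eq0P s0 /eqP/dbl_pos_eq0]; rewrite subr_le0 => vc.
apply: (@le_trans _ _ (dotp c u^T)%:E); first by rewrite lee_fin.
apply: ereal_sup_ubound; exists u^T => //; split=> [i|j].
  by rewrite -subr_le0; apply: dbl_pos_eq0; apply: s0 => // k _; exact: dbl_pos_ge0.
by move: ubx; rewrite inE => /(_ j); rewrite /= in_itv /= mxE.
Qed.

(* The convention IPGAP = +oo for an infeasible program agrees with the empty
   quantification on the right. *)
Lemma le_IPGAP A b c (g : R) : (g%:E <= IPGAP A b c)%E <->
  forall z : {ffun 'I_n -> bool}, ip_feasible A b (\col_j (z j)%:R) ->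
    ((g + dotp c (\col_j (z j)%:R))%:E <= val_LP A b c)%E.
Proof.
rewrite /IPGAP; case: asboolP => [e0|ne0].
  by split=> [_ z|]; [rewrite e0|rewrite leey].
have vecE (y : 'cV[R]_n) :
    integral_vec y -> exists z : {ffun 'I_n -> bool}, y = \col_j (z j)%:R.
  move=> yi; exists [ffun j => y j 0 == 1]; apply/colP => j; rewrite mxE ffunE.
  by case: (yi j) => ->; rewrite ?eqxx // eq_sym oner_eq0.
have [y fy] : exists y, ip_feasible A b y.
  by apply: contrapT => h; apply: ne0; rewrite -subset0 => y fy; apply: h; exists y.
have [z0 yz0] := vecE y (proj2 fy); rewrite yz0 in fy.
pose Q (z : {ffun 'I_n -> bool}) : bool := `[< ip_feasible A b (\col_j (z j)%:R) >].
have Qz0 : Q z0 by exact/asboolP.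
case: (@Order.TotalTheory.arg_maxP _ _ _ z0 Q (fun z => dotp c (\col_j (z j)%:R)) Qz0).
move=> z1 /asboolP fz1 z1max.
have -> : val_IP A b c = (dotp c (\col_j (z1 j)%:R))%:E.
  apply/eqP; rewrite eq_le; apply/andP; split.
    apply: ub_ereal_sup => _ [x fx <-]; rewrite lee_fin.
    by have [z xz] := vecE x (proj2 fx); rewrite xz in fx *; apply: z1max; exact/asboolP.
  by apply: ereal_sup_ubound; exists (\col_j (z1 j)%:R).
rewrite leeBrDr // -EFinD; split=> [h z fz|]; last exact.
by apply: le_trans h; rewrite lee_fin lerD2l; apply: z1max; exact/asboolP.
Qed.

End Excess.

Lemma measurable_setltr d (T : measurableType d) (R : realType) (f g : T -> R) :
  measurable_fun setT f -> measurable_fun setT g -> measurable [set w | f w < g w].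
Proof.
move=> /measurable_EFinP mf /measurable_EFinP mg.
by have := measurable_lte measurableT mf mg; rewrite setTI.
Qed.

Lemma measurable_setler d (T : measurableType d) (R : realType) (f g : T -> R) :
  measurable_fun setT f -> measurable_fun setT g -> measurable [set w | f w <= g w].
Proof.
move=> /measurable_EFinP mf /measurable_EFinP mg.
by have := measurable_lee measurableT mf mg; rewrite setTI.
Qed.

Section GapMeasurable.
Context {R : realType} {m n : nat} {d : measure_display} {T : measurableType d}.
Variables (A : 'I_m -> 'I_n -> T -> R) (c : 'I_n -> T -> R).
Hypothesis mA : forall i j, measurable_fun setT (A i j).
Hypothesis mc : forall j, measurable_fun setT (c j).

Let Aw w : 'M[R]_(m, n) := \matrix_(i, j) A i j w.
Let cw w : 'cV[R]_n := \col_j c j w.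

Lemma measurable_mulmx (x : 'cV[R]_n) i : measurable_fun setT (fun w => (Aw w *m x) i 0).
Proof.
rewrite (_ : (fun w => _) = fun w => \sum_j A i j w * x j 0).
  by apply: measurable_sum => j; exact: measurable_funM.
by apply/funext => w; rewrite mxE; apply: eq_bigr => j _; rewrite mxE.
Qed.

Lemma measurable_dotp (x : 'cV[R]_n) : measurable_fun setT (fun w => dotp (cw w) x).
Proof.
rewrite (_ : (fun w => _) = fun w => \sum_j c j w * x j 0).
  by apply: measurable_sum => j; exact: measurable_funM.
by apply/funext => w; rewrite dotpE; apply: eq_bigr => j _; rewrite mxE.
Qed.

Lemma measurable_le_val_LP (b : 'cV[R]_m) (v : T -> R) : measurable_fun setT v ->
  measurable [set w | ((v w)%:E <= val_LP (Aw w) b (cw w))%E].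
Proof.
move=> mv.
rewrite (_ : [set w | _] = \bigcap_(k in [set: nat])
  \bigcup_p [set w | excess (Aw w) b (cw w) (v w) (grid_point p) < k.+1%:R^-1]).
  apply: bigcap_measurable => // k _; apply: countable_bigcupT_measurable => [|p].
    exact: countableP.
  have mpos (f : T -> R) : measurable_fun setT f -> measurable_fun setT (fun w => f w + `|f w|).
    by move=> mf; apply: measurable_funD => //; exact: measurableT_comp.
  apply: measurable_setltr => //.
  apply: measurable_funD.
    apply: measurable_sum => i; apply: (mpos (fun w => (Aw w *m (grid_point p)^T) i 0 - b i 0)).
    by apply: measurable_funB => //; exact: measurable_mulmx.
  apply: (mpos (fun w => v w - dotp (cw w) (grid_point p)^T)).
  by apply: measurable_funB => //; exact: measurable_dotp.
apply/seteqP; split=> w /=.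
  by move=> /le_val_LP_grid h k _; have [p hp] := h k; exists p.
by move=> h; apply/le_val_LP_grid => k; have [p _ hp] := h k I; exists p.
Qed.

Lemma measurable_le_IPGAP (b : 'cV[R]_m) (g : R) :
  measurable [set w | (g%:E <= IPGAP (Aw w) b (cw w))%E].
Proof.
pose x (z : {ffun 'I_n -> bool}) : 'cV[R]_n := \col_j (z j)%:R.
rewrite (_ : [set w | _] = \bigcap_(z in [set: {ffun 'I_n -> bool}])
  ((~` \bigcap_(i in [set: 'I_m]) [set w | (Aw w *m x z) i 0 <= b i 0]) `|`
   [set w | ((g + dotp (cw w) (x z))%:E <= val_LP (Aw w) b (cw w))%E])).
  apply: fin_bigcap_measurable => // z _; apply: measurableU.
    apply: measurableC; apply: fin_bigcap_measurable => // i _.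
    apply: measurable_setler => //.
    exact: measurable_mulmx.
  by apply: measurable_le_val_LP; apply: measurable_funD => //; exact: measurable_dotp.
have xi z : integral_vec (x z).
  by move=> j; rewrite mxE; case: (z j); [right|left].
apply/seteqP; split=> w /=.
  move=> /le_IPGAP h z _ /=.
  have [fz|fz] := pselect (ip_feasible (Aw w) b (x z)); [right|left]; first exact: h.
  by move=> Az; apply: fz; split => // i; exact: Az.
move=> h; apply/le_IPGAP => z [Az _]; have [nf|//] := h z I.
by case: nf => i _; exact: Az.
Qed.

End GapMeasurable.

(** * Gaussian reduced costs *)

Section Laplace.
Context {R : realType}.
Variables (th : R) (th0 : 0 < th).

Lemma continuous_laplace (a : R) : continuous (fun x : R => th * expR (- (th * `|x - a|))).
Proof.
move=> x; apply: (cvgM (cvg_cst th)).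
apply: (@continuous_comp _ _ _ (fun x : R => - (th * `|x - a|)) expR); last exact: continuous_expR.
apply: cvgN; apply: (cvgM (cvg_cst th)); apply: cvg_norm.
exact: (cvgB (@cvg_id _ (nbhs x)) (cvg_cst a)).
Qed.

Lemma laplace_ge0 (a x : R) : 0 <= th * expR (- (th * `|x - a|)).
Proof. by rewrite mulr_ge0 ?expR_ge0 // ltW. Qed.

(** After a shift by [a], symmetry reduces this to twice the exponential density of rate [th] on the
    half-line. *)
Lemma integral_laplace_le (a : R) :
  (\int[lebesgue_measure]_x (th * expR (- (th * `|x - a|)))%:E <= 2%:E)%E.
Proof.
have shiftE : (fun x : R => x + a)^`()%classic = cst 1.
  apply/funext => x; rewrite derive1E deriveD // derive_cst addr0.
  exact: derive_id.
rewrite (@increasing_ge0_integration_by_substitutionT _ (fun x => x + a)); last 9 first.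
- by move=> x y; rewrite ltrD2r.
- by rewrite shiftE => x; exact: cvg_cst.
- by rewrite shiftE; exact: is_cvg_cst.
- by rewrite shiftE; exact: is_cvg_cst.
- by move=> x; exact: derivableD.
- exact: cvg_addrr_Ny.
- exact: cvg_addrr.
- exact: continuous_laplace.
- exact: laplace_ge0.
rewrite shiftE [leLHS](_ : _ =
    \int[lebesgue_measure]_x (th * expR (- (th * `|x - 0|)))%:E)%E; last first.
  by apply: eq_integral => x _; rewrite subr0 fctE /= mulr1 addrK.
rewrite ge0_symfun_integralT; last 3 first.
- exact: laplace_ge0.
- exact: continuous_laplace.
- by move=> x /=; rewrite !subr0 normrN.
rewrite -[leRHS]mule1; apply: lee_wpmul2l => //.
rewrite -(integral_exponential_pdf th0).
apply: (@le_trans _ _ (\int[lebesgue_measure]_(x in [set x : R | (0 <= x)%R])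
  (exponential_pdf th x)%:E)%E).
  rewrite le_eqVlt; apply/orP; left; apply/eqP; apply: eq_integral => x.
  rewrite inE /= => x0; rewrite exponential_pdfE // subr0 ger0_norm //.
  by rewrite mulNr.
apply: ge0_subset_integral => //.
- by rewrite -set_itvcy.
- by apply/measurable_EFinP; exact: measurable_exponential_pdf.
- by move=> x _; rewrite lee_fin exponential_pdf_ge0 // ltW.
Qed.

(* The standard normal density is at most 1/2. *)
Lemma normal_prob_le (B : set R) : measurable B ->
  (normal_prob 0 1 B <= 2^-1%:E * lebesgue_measure B)%E.
Proof.
move=> mB; rewrite /normal_prob -integral_cst //; apply: ge0_le_integral => //.
- by move=> x _; rewrite lee_fin normal_pdf_ge0.
- apply/measurable_EFinP/measurable_funTS; exact: measurable_normal_pdf.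
- move=> x _; rewrite lee_fin.
  (* The peak is [1 / sqrt (2 pi)], and [pi >= 2]. *)
  apply: le_trans (normal_pdf_ub 0 x (oner_neq0 _)) _.
  rewrite /normal_peak lef_pV2 ?posrE //; last first.
    by rewrite sqrtr_gt0 expr1n mul1r pmulrn_lgt0 // pi_gt0.
  rewrite -[X in X <= _](@ger0_norm _ 2) // -sqrtr_sqr ler_wsqrtr //.
  by have := @pi_ge2 R; rewrite expr1n mul1r mulr2n; lra.
Qed.

(* [R] and [measurableTypeR R] carry the same sigma-algebra but different
   displays. *)
Let idTR : measurableTypeR R -> R := idfun.

#[local] HB.instance Definition _ :=
  @isMeasurableFun.Build _ _ _ _ idTR (@measurable_id _ _ setT).

(** The law of [X] is dominated by half of Lebesgue measure, under which the kernel has mass at most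
    1. *)
Lemma integral_laplace_normal d (T : measurableType d) (P : probability T R)
    (X : {RV P >-> R}) (a : R) : standard_normal X ->
  (\int[distribution P X]_x (th * expR (- (th * `|x - a|)))%:E <= 1)%E.
Proof.
move=> nX; have mL : measurable_fun setT (fun x : R => (th * expR (- (th * `|x - a|)))%:E).
  by apply/measurable_EFinP; apply: continuous_measurable_fun; exact: continuous_laplace.
have h0 : 0 <= 2^-1 :> R by rewrite invr_ge0.
pose half : {measure set (measurableTypeR R) -> \bar R} := mscale (NngNum h0) lebesgue_measure.
apply: (@le_trans _ _ (\int[pushforward half idTR]_x (th * expR (- (th * `|x - a|)))%:E)%E).
  apply: ge0_le_measure_integral => //.
  - move=> B mB; have := normal_prob_le mB; rewrite -(nX B mB); exact.
  - by move=> x; rewrite lee_fin laplace_ge0.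
rewrite ge0_integral_pushforward //; last by move=> x _; rewrite lee_fin laplace_ge0.
rewrite preimage_setT ge0_integral_mscale //; last by move=> x _; rewrite lee_fin laplace_ge0.
apply: (@le_trans _ _ (2^-1%:E * 2%:E)%E).
  by apply: lee_wpmul2l; [rewrite lee_fin|exact: integral_laplace_le].
by rewrite -EFinM mulVf.
Qed.

End Laplace.

(** * Integration against an independent variable *)

Section Independence.
Context {d : measure_display} {T : measurableType d} {R : realType}.
Variables (P : probability T R) (X : {RV P >-> R}) (G : set (set T)).
Hypothesis Gm : G `<=` measurable.
Hypothesis indepX : forall B D, measurable B -> <<s G >> D ->
  P (X @^-1` B `&` D) = (P (X @^-1` B) * P D)%E.

Let T' := g_sigma_algebraType G.

(** The identity, seen as a random element for the sigma-algebra generated by [G]; its law is [P]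
    restricted to that sigma-algebra. *)
Let coarse : T -> T' := id.

Let measurable_coarse : measurable_fun setT coarse.
Proof.
move=> _ D mD; rewrite setTI.
exact: (smallest_sub (@sigma_algebra_measurable _ T) Gm).
Qed.

#[local] HB.instance Definition _ := @isMeasurableFun.Build _ _ _ _ coarse measurable_coarse.

(** Independence makes the joint law of [X] and [coarse] a product measure, and Tonelli's theorem
    applies. *)
Lemma integral_indep (f : R * T' -> \bar R) :
  measurable_fun setT f -> (forall z, (0 <= f z)%E) ->
  (\int[P]_w f (X w, coarse w) =
   \int[distribution P coarse]_w \int[distribution P X]_x f (x, w))%E.
Proof.
move=> mf f0.
pose pr w : R * T' := (X w, coarse w).
have mpr : measurable_fun setT pr.
  by apply: measurable_fun_pair => //; exact: measurable_funPT.
pose Q := [the {mfun T >-> (R * T')%type} of mfun_Sub (mem_set mpr)].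
have -> : (\int[P]_w f (X w, coarse w) = \int[distribution P Q]_z f z)%E.
  rewrite ge0_integral_pushforward // => z _; exact: f0.
rewrite -(@fubini_tonelli2 _ _ _ _ _ (distribution P X) (distribution P coarse) f) //.
apply: eq_measure_integral => E mE _; apply/esym.
by apply: product_measure_unique => // B D; exact: indepX.
Qed.

(** With the coarse information fixed, [g] and the centre [f] are constants, and the inner integral
    over [X] is at most 1. *)
Lemma integral_laplace_indep (th : R) (g f : T -> R) : 0 < th ->
  standard_normal X ->
  measurable_fun [set: T'] g -> (forall w, 0 <= g w) ->
  measurable_fun [set: T'] f ->
  (\int[P]_w (g w * (th * expR (- (th * `|X w - f w|))))%:E <= \int[P]_w (g w)%:E)%E.
Proof.
move=> th0 nX mg g0 mf.
pose F (z : R * T') : \bar R := (g z.2 * (th * expR (- (th * `|z.1 - f z.2|))))%:E.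
have mF : measurable_fun setT F.
  apply/measurable_EFinP; apply: measurable_funM.
    by apply: (measurableT_comp mg); exact: measurable_snd.
  apply: measurable_funM => //; apply: measurableT_comp => //.
  apply: measurableT_comp => //; apply: measurable_funM => //.
  apply: measurableT_comp => //; apply: measurable_funB; first exact: measurable_fst.
  by apply: (measurableT_comp mf); exact: measurable_snd.
rewrite (_ : (\int[P]_w (g w * _)%:E = \int[P]_w F (X w, coarse w))%E) //.
rewrite integral_indep //; last first.
  by move=> z; rewrite lee_fin mulr_ge0 // laplace_ge0.
have mgE : measurable_fun [set: T'] (fun w => (g w)%:E) by exact/measurable_EFinP.
have -> : (\int[P]_w (g w)%:E = \int[distribution P coarse]_w (g w)%:E)%E.
  by rewrite ge0_integral_pushforward // => w _; rewrite lee_fin.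
apply: ge0_le_integral => //.
- by move=> w _; apply: integral_ge0 => x _; rewrite lee_fin mulr_ge0 // laplace_ge0.
- apply: (measurable_fun_fubini_tonelli_G _ mF) => z.
  by rewrite lee_fin mulr_ge0 // laplace_ge0.
- move=> w _; rewrite /F /=.
  under eq_integral do rewrite EFinM.
  rewrite ge0_integralZl //.
  + by rewrite -[leRHS]mule1 lee_wpmul2l ?lee_fin // integral_laplace_normal.
  + apply/measurable_EFinP; apply: continuous_measurable_fun; exact: continuous_laplace.
  + by move=> x _; rewrite lee_fin laplace_ge0.
  + by rewrite lee_fin.
Qed.

End Independence.

Section Family.
Context {d : measure_display} {T : measurableType d} {R : realType}.
Variables (P : probability T R) (I : finType) (X : I -> {RV P >-> R}) (k0 : I).

(* A pi-system generating the sigma-algebra of the variables other than [X k0]. *)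
Definition others : set (set T) :=
  [set D | exists2 B : I -> set R, (forall i, measurable (B i)) &
    D = [set w | forall i, i != k0 -> B i (X i w)]].

Lemma measurable_preimage (B : I -> set R) (J : pred I) :
  (forall i, measurable (B i)) -> measurable [set w | forall i, J i -> B i (X i w)].
Proof.
move=> mB; rewrite (_ : [set w | _] = \bigcap_(i in [set i | J i]) (X i @^-1` B i)).
  by apply: fin_bigcap_measurable => // i _; exact: measurable_funPTI.
by apply/seteqP; split.
Qed.

Lemma others_measurable : others `<=` measurable.
Proof. by move=> _ [B mB ->]; exact: measurable_preimage. Qed.

Lemma measurable_others k : k != k0 ->
  measurable_fun [set: g_sigma_algebraType others] (X k).
Proof.
move=> kk0 _ B mB; rewrite setTI; apply: sub_sigma_algebra.
exists (fun i => if i == k then B else setT) => [i|]; first by case: eqP.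
apply/seteqP; split=> w /=; first by move=> h i _; case: eqP => // ->.
by move=> /(_ k kk0); rewrite eqxx.
Qed.

(** For fixed [B], both sides are finite measures in [D] that agree on the pi-system [others], hence
    on the sigma-algebra it generates. *)
Lemma indep_others : mutually_independent X ->
  forall B D, measurable B -> <<s others >> D ->
  P (X k0 @^-1` B `&` D) = (P (X k0 @^-1` B) * P D)%E.
Proof.
move=> ind B D mB sD.
have mXB : measurable (X k0 @^-1` B) by exact: measurable_funPTI.
have p0 : 0 <= fine (P (X k0 @^-1` B)) by exact: fine_ge0.
have pE : (P (X k0 @^-1` B) = (fine (P (X k0 @^-1` B)))%:E)%E.
  by rewrite fineK // fin_num_measure.
rewrite setIC [in RHS]pE.
rewrite -[LHS]/(mrestr P mXB D) -[RHS]/(mscale (NngNum p0) P D).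
have setT_others : others setT.
  by exists (fun=> setT) => //; apply/seteqP; split.
apply: (@g_sigma_algebra_measure_unique _ _ _ others others_measurable (fun=> setT)) => //.
- by apply/seteqP; split => // w _; exists 0%N.
- move=> _ _ [B1 mB1 ->] [B2 mB2 ->]; exists (fun i => B1 i `&` B2 i).
    by move=> i; exact: measurableI.
  apply/seteqP; split=> w /=; first by move=> [h1 h2] i ik; split; [exact: h1|exact: h2].
  by move=> h; split=> i ik; have [] := h i ik.
- move=> _ [C mC ->]; set D' := [set w | _].
  suff : (P (D' `&` X k0 @^-1` B) = P (X k0 @^-1` B) * P D')%E.
    by move=> e; rewrite [LHS]e {1}pE.
  (* Mutual independence is used twice, with and without the index [k0]; the two products differ by
     the factor of [B]. *)
  pose C' i := if i == k0 then B else C i.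
  have mC' i : measurable (C' i) by rewrite /C'; case: eqP.
  have := ind [set: I]%SET C' mC'; have := ind [set~ k0]%SET C' mC'.
  rewrite [X in _ = X -> _](_ : _ = (\prod_(i | i != k0) P (X i @^-1` C' i))%E); last first.
    by apply: eq_bigl => i; rewrite !inE.
  move=> e1; rewrite (bigD1 k0) ?inE //=.
  rewrite (eq_bigl (fun i => i != k0)) => [|i]; last by rewrite inE.
  rewrite -e1 {2}/C' eqxx => e2.
  transitivity (P [set w | forall i, i \in [set: I]%SET -> C' i (X i w)]).
    congr (P _); apply/seteqP; split=> w /=.
      move=> [h hB] i _; rewrite /C'; case: eqP => [->//|/eqP ik]; exact: h.
    move=> h; split=> [i ik|]; last by have := h k0; rewrite /C' eqxx inE; apply.
    by have := h i; rewrite /C' (negPf ik) inE; apply.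
  rewrite e2; congr (_ * P _)%E; apply/seteqP; split=> w /=.
    move=> h i ik; have := h i; rewrite !inE ik /C' (negPf ik); exact.
  by move=> h i; rewrite !inE => ik; rewrite /C' (negPf ik); exact: h.
- by move=> k; change (P (setT `&` X k0 @^-1` B) < +oo)%E; rewrite setTI ltey_eq fin_num_measure.
Qed.

End Family.

Section MeasurableMultiplier.
Context {d : measure_display} {T : measurableType d} {R : realType}.

Lemma measurable_fun_inv (f : T -> R) :
  measurable_fun setT f -> measurable_fun setT (fun w => (f w)^-1).
Proof.
move=> mf; apply: (@measurableT_comp _ _ _ _ _ _ (@GRing.inv R)) => //.
rewrite -(setUv [set 0 : R]); apply/measurable_funU => //.
  exact: measurableC.
split; first exact: measurable_fun_set1.
apply: open_continuous_measurable_fun.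
  by rewrite openC; exact: closed_eq.
by move=> x; rewrite inE => /eqP x0; exact: inv_continuous.
Qed.

Lemma measurable_det p (M : T -> 'M[R]_p) :
  (forall i j, measurable_fun setT (fun w => M w i j)) ->
  measurable_fun setT (fun w => \det (M w)).
Proof.
move=> mM; rewrite /determinant; apply: measurable_sum => s.
by apply: measurable_funM => //; apply: measurable_prod => i _; exact: mM.
Qed.

Context {m n : nat}.
Variables (A : 'I_m -> 'I_n -> T -> R) (c : 'I_n -> T -> R).
Variable f : {ffun 'I_m -> 'I_m + 'I_n}.
Hypothesis mA : forall i j, measurable_fun setT (A i j).
Hypothesis mc : forall k j, f k = inr j -> measurable_fun setT (c j).

Let Aw w : 'M[R]_(m, n) := \matrix_(i, j) A i j w.
Let cw w : 'cV[R]_n := \col_j c j w.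

Lemma measurable_sel_mx i k : measurable_fun setT (fun w => sel_mx (Aw w) f i k).
Proof.
rewrite /sel_mx; under eq_fun do rewrite mxE.
case: (f k) => [l|j]; first exact: measurable_cst.
by under eq_fun do rewrite mxE; exact: mA.
Qed.

(** Cramer's rule is measurable in [A] and the selected costs. Asking [mc] only of these lets the
    lemma run on the sigma-algebra that omits an unselected cost. *)
Lemma measurable_multiplier j :
  measurable_fun setT (fun w => (multiplier (Aw w) (cw w) f *m Aw w) 0 j).
Proof.
under eq_fun do rewrite mxE.
apply: measurable_sum => i; apply: measurable_funM; last first.
  by under eq_fun do rewrite mxE; exact: mA.
rewrite /multiplier; under eq_fun do rewrite 2!mxE.
apply: measurable_funM.
  by apply: measurable_fun_inv; apply: measurable_det => *; exact: measurable_sel_mx.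
apply: measurable_sum => k; apply: measurable_funM.
  under eq_fun do rewrite mxE.
  case E: (f k) => [l|j0]; first exact: measurable_cst.
  by under eq_fun do rewrite mxE; exact: mc E.
under eq_fun do rewrite mxE; rewrite /cofactor.
apply: measurable_funM => //; apply: measurable_det => i0 j0.
by under eq_fun do rewrite 2!mxE; exact: measurable_sel_mx.
Qed.

End MeasurableMultiplier.

(** The factor of coordinate [j] in the product of [card_near_greedy]. *)
Definition weight {R : realType} {m n : nat} (th : R) (A : 'M[R]_(m, n))
    (c : 'cV[R]_n) (f : {ffun 'I_m -> 'I_m + 'I_n}) (j : 'I_n) : R :=
  1 + expR (- (th * `|reduced_cost A c (multiplier A c f) j|)).

Lemma weight_ge1 {R : realType} {m n : nat} (th : R) (A : 'M[R]_(m, n))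
  (c : 'cV[R]_n) f j : 1 <= weight th A c f j.
Proof. by rewrite lerDl expR_ge0. Qed.

Lemma measurable_weights {d : measure_display} {T : measurableType d}
    {R : realType} {m n : nat} (th : R) (A : 'I_m -> 'I_n -> T -> R)
    (c : 'I_n -> T -> R) (f : {ffun 'I_m -> 'I_m + 'I_n}) (s : seq 'I_n) :
  (forall i j, measurable_fun setT (A i j)) ->
  (forall k j, f k = inr j -> measurable_fun setT (c j)) ->
  {in s, forall j, measurable_fun setT (c j)} ->
  measurable_fun setT (fun w =>
    \prod_(j <- s) weight th (\matrix_(i, j) A i j w) (\col_j c j w) f j).
Proof.
move=> mA mc ms; apply: measurable_prod => j js.
apply: measurable_funD => //; apply: measurableT_comp => //.
apply: measurableT_comp => //; apply: measurable_funM => //.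
apply: measurableT_comp => //; apply: measurable_funB; last exact: measurable_multiplier.
by under eq_fun do rewrite mxE; exact: ms.
Qed.

(** * Expected weights and their tail *)

Section Expectation.
Context {d : measure_display} {T : measurableType d} {R : realType}.
Variables (P : probability T R) (m n : nat).
Variables (A : 'I_m -> 'I_n -> {RV P >-> R}) (c : 'I_n -> {RV P >-> R}).
Hypothesis iid : iid_standard_normal A c.
Variables (th : R) (th0 : 0 < th).
Implicit Types (f : {ffun 'I_m -> 'I_m + 'I_n}) (s : seq 'I_n) (w : T).

Let mA i j : measurable_fun setT (A i j). Proof. exact: measurable_funPT. Qed.
Let mc j : measurable_fun setT (c j). Proof. exact: measurable_funPT. Qed.

Lemma measurable_random_weights f s : measurable_fun setT (fun w =>
  \prod_(j <- s) weight th (random_mx A w) (random_vec c w) f j).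
Proof. exact: (@measurable_weights _ _ _ _ _ th A c). Qed.

Lemma random_weights_ge0 f s w :
  0 <= \prod_(j <- s) weight th (random_mx A w) (random_vec c w) f j.
Proof. by apply: prodr_ge0 => j _; apply: le_trans (weight_ge1 _ _ _ _ _). Qed.

(* The multipliers depend on A and on the c_j selected by f only, so that each
   remaining c_j is independent of everything else in its reduced cost. *)
Lemma expectation_weights_le f s : uniq s ->
  {in s, forall j (k : 'I_m), f k != inr j} ->
  (\int[P]_w (\prod_(j <- s) weight th (random_mx A w) (random_vec c w) f j)%:E
   <= ((1 + th^-1) ^+ size s)%:E)%E.
Proof.
elim: s => [_ _|j s IH /= /andP[js us] sf].
  under eq_integral do rewrite big_nil.
  by rewrite integral_cst //= mul1e expr0 probability_le1.
have [ind nrm] := iid.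
set X := fun k : 'I_m * 'I_n + 'I_n => _ in ind nrm.
pose G := others X (inr j).
have mAG i j' : measurable_fun [set: g_sigma_algebraType G] (A i j').
  exact: (@measurable_others _ _ _ P _ X (inr j) (inl (i, j'))).
have mcG j' : j' != j -> measurable_fun [set: g_sigma_algebraType G] (c j').
  by move=> jj'; apply: (@measurable_others _ _ _ P _ X (inr j) (inr j')).
have fj k j' : f k = inr j' -> j' != j.
  by apply: contra_eqN => /eqP ->; apply: sf; exact: mem_head.
have mfG k j' : f k = inr j' -> measurable_fun [set: g_sigma_algebraType G] (c j').
  by move=> /fj; exact: mcG.
pose H w := \prod_(j <- s) weight th (random_mx A w) (random_vec c w) f j.
have mHG : measurable_fun [set: g_sigma_algebraType G] H.
  apply: (@measurable_weights _ (g_sigma_algebraType G) _ _ _ th A c f s) => //.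
  by move=> j' j's; apply: mcG; apply: contraNneq js => <-.
pose F w := (multiplier (random_mx A w) (random_vec c w) f *m random_mx A w) 0 j.
have mFG : measurable_fun [set: g_sigma_algebraType G] F.
  exact: (@measurable_multiplier _ (g_sigma_algebraType G) _ _ _ A c f).
have mH : measurable_fun setT H := measurable_random_weights f s.
have mF : measurable_fun setT F :=
  @measurable_multiplier _ _ _ _ _ A c f mA (fun _ j _ => mc j) j.
have H0 w : 0 <= H w := random_weights_ge0 f s w.
(* The weight of [j] is [1 + th^-1 * L], and [L] integrates to at most 1 against anything
   independent of [c j]; this gives one factor [1 + th^-1]. *)
pose L w := th * expR (- (th * `|c j w - F w|)).
have L0 w : 0 <= L w by rewrite mulr_ge0 ?expR_ge0 // ltW.
have mL : measurable_fun setT L.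
  apply: measurable_funM => //; apply: measurableT_comp => //.
  apply: measurableT_comp => //; apply: measurable_funM => //.
  by apply: measurableT_comp => //; exact: measurable_funB.
rewrite (_ : \int[P]_w _ = \int[P]_w ((H w)%:E + th^-1%:E * (H w * L w)%:E))%E; last first.
  apply: eq_integral => w _; rewrite -EFinM -EFinD; congr (_%:E).
  rewrite big_cons -/(H w) /weight /reduced_cost [random_vec c w j 0]mxE -/(F w).
  rewrite /L mulrDl mul1r; congr (_ + _).
  by rewrite [RHS]mulrCA mulKf ?gt_eqF // mulrC.
have mHL : measurable_fun setT (fun w => (H w * L w)%:E).
  by apply/measurable_EFinP; exact: measurable_funM.
have HL0 w : (0 <= (H w * L w)%:E)%E by rewrite lee_fin mulr_ge0.
have th1 : 0 <= th^-1 by rewrite invr_ge0 ltW.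
rewrite ge0_integralD //; last 4 first.
- by move=> w _; rewrite lee_fin.
- exact/measurable_EFinP.
- by move=> w _; rewrite mule_ge0 // lee_fin.
- exact: measurable_funeM.
rewrite ge0_integralZl //.
have step := @integral_laplace_indep _ _ _ P (c j) G (@others_measurable _ _ _ P _ X (inr j))
  (@indep_others _ _ _ P _ X (inr j) ind) th H F th0 (nrm (inr j)) mHG H0 mFG.
have IHs := IH us (fun j' j's => sf j' (mem_behead (s := j :: s) j's)).
apply: (@le_trans _ _ ((1 + th^-1)%:E * \int[P]_w (H w)%:E)%E).
  rewrite EFinD ge0_muleDl ?lee_fin // mul1e leeD2l //.
  by apply: lee_wpmul2l; rewrite ?lee_fin.
rewrite exprS EFinM; apply: lee_wpmul2l IHs.
by rewrite lee_fin addr_ge0.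
Qed.

Definition unselected (f : {ffun 'I_m -> 'I_m + 'I_n}) : seq 'I_n :=
  enum [pred j | [forall k, f k != inr j]].

(** The dual vertex that governs a tree depends on the sample, so all choices [f] are summed. *)
Definition total_weight w := \sum_f
  \prod_(j <- unselected f) weight th (random_mx A w) (random_vec c w) f j.

Let Nf : R := #|{ffun 'I_m -> 'I_m + 'I_n}|%:R.

Lemma measurable_total_weight : measurable_fun setT total_weight.
Proof. by apply: measurable_sum => f; exact: measurable_random_weights. Qed.

Lemma total_weight_ge0 w : 0 <= total_weight w.
Proof. by apply: sumr_ge0 => f _; exact: random_weights_ge0. Qed.

Lemma expectation_total_weight_le :
  (\int[P]_w (total_weight w)%:E <= (Nf * (1 + th^-1) ^+ n)%:E)%E.
Proof.
under eq_integral do rewrite -sumEFin.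
rewrite ge0_integral_sum //; last 2 first.
- by move=> f; apply/measurable_EFinP; exact: measurable_random_weights.
- by move=> f w _; rewrite lee_fin random_weights_ge0.
rewrite /Nf mulr_natl -sumr_const -sumEFin; apply: lee_sum => f _.
apply: le_trans (expectation_weights_le _ _) _.
- exact: enum_uniq.
- by move=> j; rewrite mem_enum => /forallP.
rewrite lee_fin ler_weXn2l //; first by rewrite lerDl invr_ge0 ltW.
by rewrite -cardE -[leqRHS]card_ord max_card.
Qed.

Lemma total_weight_tail (M : R) : 0 < M ->
  (P [set w | (M <= total_weight w)%R] <= (Nf * (1 + th^-1) ^+ n / M)%:E)%E.
Proof.
move=> M0.
have mt : measurable_fun setT (EFin \o total_weight).
  by apply/measurable_EFinP; exact: measurable_total_weight.
(* Markov's inequality. *)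
have := @le_integral_comp_abse _ _ _ P setT measurableT (EFin \o total_weight) M id
  (@measurable_id _ _ _) (fun _ h => h) (fun _ _ _ _ h => h) mt M0.
rewrite setTI /=.
rewrite (_ : [set x | (M%:E <= `|(total_weight x)%:E|)%E] =
    [set w | M <= total_weight w]); last first.
  by apply/seteqP; split=> w /=; rewrite ger0_norm ?total_weight_ge0 ?lee_fin.
under eq_integral => w _ do rewrite /= ger0_norm ?total_weight_ge0 //.
move=> /le_trans/(_ expectation_total_weight_le) h.
by rewrite EFinM muleC lee_pdivlMl.
Qed.

End Expectation.

(** * The tail bound on the tree size *)

(** The m equations select at most m indices, and each weight is at most 2. *)
Lemma prod_weights_le {R : realType} {m n : nat} (th : R) (A : 'M[R]_(m, n))
    (c : 'cV[R]_n) (f : {ffun 'I_m -> 'I_m + 'I_n}) : 0 <= th ->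
  \prod_j weight th A c f j <= 2 ^+ m * \prod_(j <- unselected f) weight th A c f j.
Proof.
move=> th0; have w0 j : 0 <= weight th A c f j := le_trans ler01 (weight_ge1 _ _ _ _ _).
have w2 j : weight th A c f j <= 2.
  rewrite /weight -[X in _ <= X](_ : 1 + 1 = 2) // lerD2l -[leRHS]expR0 ler_expR.
  by rewrite oppr_le0 mulr_ge0.
rewrite (bigID (fun j => [forall k, f k != inr j])) /= mulrC /unselected.
rewrite big_enum /=.
apply: ler_wpM2r; first exact: prodr_ge0.
pose S : {set 'I_n} := [set j | ~~ [forall k, f k != inr j]]%SET.
apply: (@le_trans _ _ (\prod_(j in S) (2 : R))).
  rewrite [leRHS](eq_bigl (fun j => ~~ [forall k, f k != inr j])) => [|j]; last by rewrite inE.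
  by apply: ler_prod => j _; rewrite w0 w2.
rewrite prodr_const ler_weXn2l ?ler1n //.
pose g (k : 'I_m) : option 'I_n := if f k is inr j then Some j else None.
rewrite -(card_imset _ (@Some_inj _)).
rewrite -[X in (_ <= X)%N]card_ord -cardsT.
apply: leq_trans (leq_imset_card g [set: 'I_m]%SET).
apply: subset_leq_card; apply/fintype.subsetP => _ /imsetP[j jS ->].
move: jS; rewrite inE => /forallPn[k]; rewrite negbK => /eqP fk.
by apply/imsetP; exists k; rewrite ?inE // /g fk.
Qed.

(** With [L = ln n] and [a = sqrt t * m^(5/4)], the right side is the exponential of
    [10^8 a (m + L)]; every factor on the left is put into the exponent and compared. *)
Lemma size_bound {R : realType} (m n : nat) (t s : R) :
  (0 < m)%N -> (m <= n)%N -> (3 <= n)%N -> 1 <= t ->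
  s = Num.sqrt (10 ^+ 15 * t * gap_rate m n) ->
  1 + 2 * (n%:R * (expR s * (2 ^+ m * ((m + n)%:R ^+ m * expR s * n%:R ^+ 7)))) <=
  expR (10 ^+ 8 * Num.sqrt t * m%:R `^ (9 / 4)) *
  n%:R `^ (10 ^+ 8 * Num.sqrt t * m%:R `^ (5 / 4)).
Proof.
move=> m0 mn n3 t1 sE.
have n0 : 0 < n%:R :> R by rewrite ltr0n (leq_trans _ n3).
have m1 : 1 <= m%:R :> R by rewrite ler1n.
have mgt0 : 0 < m%:R :> R by rewrite ltr0n.
pose L : R := ln n%:R; pose q : R := m%:R `^ (5 / 4).
have L0 : 0 <= L by rewrite ln_ge0 // ler1n (leq_trans _ n3).
have nL : n%:R = expR L by rewrite lnK.
have qm : m%:R <= q.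
  rewrite -[leLHS]powRr1 ?ler0n // /q; apply: ler_powR => //; lra.
have q94 : m%:R `^ (9 / 4) = q * m%:R.
  rewrite -[X in q * X]powRr1 ?ler0n // /q -powRD ?gt_eqF ?implybT //.
  by congr (_ `^ _); lra.
have q52 : m%:R `^ (5 / 2) = q ^+ 2.
  rewrite expr2 /q -powRD ?gt_eqF ?implybT //; by congr (_ `^ _); lra.
have st1 : 1 <= Num.sqrt t by rewrite -[leLHS]sqrtr1 ler_wsqrtr.
pose a := Num.sqrt t * q.
have am : m%:R <= a.
  by apply: le_trans qm _; rewrite ler_peMl // powR_ge0.
(* The factor [4 * 10 ^+ 7] exceeds the square root of [10 ^+ 15], as [10 <= 4 ^+ 2]. *)
have sa : s <= 4 * 10 ^+ 7 * (a * (m%:R + L)).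
  have z0 : 0 <= 4 * 10 ^+ 7 * (a * (m%:R + L)).
    apply: mulr_ge0; first by rewrite mulr_ge0 // exprn_ge0.
    by rewrite mulr_ge0 ?addr_ge0 // (le_trans _ am).
  rewrite sE -[leRHS]ger0_norm // -sqrtr_sqr ler_wsqrtr //.
  rewrite /gap_rate q52 -/L !exprMn sqr_sqrtr ?(le_trans ler01) //.
  rewrite (_ : 10 ^+ 15 * t * (q ^+ 2 * (m%:R + L) ^+ 2) =
    10 ^+ 15 * (t * q ^+ 2 * (m%:R + L) ^+ 2)); last ring.
  rewrite -[leRHS](_ : (4 ^+ 2 * (10 ^+ 7) ^+ 2) * (t * q ^+ 2 * (m%:R + L) ^+ 2) = _); last ring.
  apply: ler_wpM2r; first by rewrite mulr_ge0 ?sqr_ge0 // mulr_ge0 ?sqr_ge0 // (le_trans ler01).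
  rewrite -exprM exprS; apply: ler_wpM2r; first exact: exprn_ge0.
  by rewrite -natrX ler_nat.
have mnle : (m + n)%:R <= expR (2 * L).
  rewrite mulr_natl mulr2n expRD -nL -natrM ler_nat.
  apply: (@leq_trans (n + n)); first by rewrite leq_add2r.
  by rewrite addnn -muln2 leq_mul2l (ltnW n3) orbT.
have two : 2 <= expR 1 :> R by have := @expR_ge1Dx R 1; lra.
pose x := n%:R * (expR s * (2 ^+ m * ((m + n)%:R ^+ m * expR s * n%:R ^+ 7))).
have xle : x <= expR (8 * L + 2 * s + m%:R + 2 * L * m%:R).
  rewrite (_ : expR _ =
    n%:R * (expR s * (expR 1 ^+ m * (expR (2 * L) ^+ m * expR s * n%:R ^+ 7)))); last first.
    rewrite nL -!expRM_natl -!expRD; congr expR.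
    ring.
  rewrite /x; apply: ler_wpM2l; first exact: ltW.
  apply: ler_wpM2l; first exact: expR_ge0.
  apply: ler_pM; rewrite ?exprn_ge0 ?mulr_ge0 ?exprn_ge0 ?expR_ge0 ?ler0n //.
    by rewrite lerXn2r ?nnegrE ?expR_ge0.
  apply: ler_wpM2r; first by rewrite exprn_ge0 ?ler0n.
  apply: ler_wpM2r; first exact: expR_ge0.
  by rewrite lerXn2r ?nnegrE ?expR_ge0 ?ler0n.
have s0 : 0 <= s by rewrite sE sqrtr_ge0.
set y := expR _ in xle.
have y1 : 1 <= y.
  rewrite -[leLHS]expR0 ler_expR !addr_ge0 ?mulr_ge0 ?ler0n //.
(* Since [n >= 3], the bound [1 + 2 x <= 3 y] costs only one more factor n. *)
apply: (@le_trans _ _ (n%:R * y)).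
  apply: (@le_trans _ _ (3 * y)); first by rewrite -/x; lra.
  by rewrite ler_wpM2r ?(le_trans ler01) // ler_nat.
rewrite {2}nL -expRM -expRD.
rewrite /y nL -expRD ler_expR q94 -/q.
rewrite -[X in _ <= X](_ : 10 ^+ 8 * (a * (m%:R + L)) = _); last by rewrite /a; ring.
have aL : m%:R * L <= a * L by rewrite ler_wpM2r.
have L1 : L <= m%:R * L by rewrite ler_peMl.
have ama : m%:R <= a * m%:R by rewrite ler_peMl // (le_trans m1).
have aL0 : 0 <= a * L by rewrite mulr_ge0 // (le_trans _ am).
have am0 : 0 <= a * m%:R by rewrite mulr_ge0 // (le_trans _ am).
have Z0 : 0 <= a * (m%:R + L) by rewrite mulrDr addr_ge0.
(* The term [2 s] takes [8 * 10^7] of the [10^8]; the rest, [9 L + m + 2 m L], is at most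
   [11 a (m + L)]. *)
have g11 : 11 <= 2 * (10 : R) ^+ 7.
  have : (10 : R) ^+ 1 <= 10 ^+ 7 by rewrite ler_weXn2l // ler1n.
  by rewrite expr1; lra.
have h11 := ler_wpM2r Z0 g11; have h8 : (10 : R) ^+ 8 = 10 * 10 ^+ 7 := exprS _ _.
move: sa h11; rewrite h8; move: ((10 : R) ^+ 7) => g.
have e k : k * g * (a * (m%:R + L)) = k * (g * (a * (m%:R + L))) by rewrite mulrA.
rewrite !e; move: (g * _) => W; rewrite mulrDr -[2 * L * _]mulrA [L * m%:R]mulrC.
move: (a * L) (a * m%:R) (m%:R * L) aL L1 ama aL0 am0 => *; lra.
Qed.

Theorem corollary1 (R : realType) (C : R) (hC : 200 <= C)
    (hgap : gap_tail_property C) :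
  exists K : R, 0 < K /\
  forall (m n : nat) (b : 'cV[R]_m), admissible C n b ->
  forall (d : measure_display) (T : measurableType d) (P : probability T R)
    (A : 'I_m -> 'I_n -> {RV P >-> R}) (c : 'I_n -> {RV P >-> R}),
  iid_standard_normal A c ->
  forall t : R, 1 <= t <= n%:R / (C * gap_rate m n) ->
  with_prob_at_least P (1 - 4 * (1 - 25^-1) `^ t - 2 / n%:R ^+ 7)
    [set w | forall tree : bb_tree n,
       is_bb_tree (random_mx A w) b (random_vec c w) tree ->
       (bb_size tree)%:R <=
         expR (K * Num.sqrt t * m%:R `^ (9 / 4)) *
         n%:R `^ (K * Num.sqrt t * m%:R `^ (5 / 4))].
Proof.
exists (10 ^+ 8); split; first exact: exprn_gt0.
move=> m n b adm d T P A c iid t tb; have [m0 Cmn _] := adm.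
have /andP[t1 _] := tb.
have m1 : 1 <= m%:R :> R by rewrite ler1n.
have mn200 : 200 * m%:R <= n%:R :> R.
  apply: le_trans Cmn; apply: ler_pM => //.
  rewrite -[leLHS]powRr1 ?ler0n //; apply: ler_powR => //; lra.
have mn : (m <= n)%N by rewrite -(ler_nat R); lra.
have n3 : (3 <= n)%N by rewrite -(ler_nat R); lra.
have n0 : 0 < n%:R :> R by rewrite ltr0n (leq_trans _ n3).
have L0 : 0 <= ln n%:R :> R by rewrite ln_ge0 // ler1n (leq_trans _ n3).
have gr0 : 0 < gap_rate m n :> R.
  by rewrite /gap_rate mulr_gt0 ?powR_gt0 ?exprn_gt0 //; lra.
have sq0 : 0 < 10 ^+ 15 * t * gap_rate m n.
  by apply: mulr_gt0 => //; rewrite mulr_gt0 ?exprn_gt0 // (lt_le_trans ltr01).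
pose s := Num.sqrt (10 ^+ 15 * t * gap_rate m n).
have s0 : 0 < s by rewrite sqrtr_gt0.
pose g := 10 ^+ 15 * t * (gap_rate m n / n%:R).
(* The choice [th = sqrt (n / g)] balances [th g] against [n / th]. *)
pose th := n%:R / s.
have th0 : 0 < th by rewrite divr_gt0.
have thg : th * g = s.
  have ss : s ^+ 2 = 10 ^+ 15 * t * gap_rate m n by rewrite sqr_sqrtr ?ltW.
  move: ss (lt0r_neq0 s0) (lt0r_neq0 n0); rewrite /th /g.
  move: {s0 th th0} s (n%:R : R) (gap_rate m n : R) (10 ^+ 15 * t) => s' n' r' k ss sn0 nn0.
  rewrite -[RHS](mulfK sn0) -expr2 ss; by field; rewrite sn0 nn0.
(* From [1 + u <= exp u], with [n / th = s]. *)
have thV : (1 + th^-1) ^+ n <= expR s.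
  have -> : s = th^-1 * n%:R by rewrite /th invf_div divfK ?lt0r_neq0.
  by rewrite expRM_natr lerXn2r ?nnegrE ?expR_ge0 ?addr_ge0 ?invr_ge0 ?expR_ge1Dx // ltW.
(* The threshold is the bound on the expected total weight times [n^7], so Markov's inequality
   leaves probability [n^-7]. *)
pose M := (m + n)%:R ^+ m * expR s * n%:R ^+ 7 : R.
have mn0 : 0 < (m + n)%:R ^+ m :> R by rewrite exprn_gt0 // ltr0n addn_gt0 m0.
have M0 : 0 < M by apply: mulr_gt0; [apply: mulr_gt0 => //; exact: expR_gt0|exact: exprn_gt0].
pose bad1 := [set w | ((10 ^+ 15 * t * (gap_rate m n / n%:R))%:E <=
  IPGAP (random_mx A w) b (random_vec c w))%E].
pose bad2 := [set w | M <= total_weight A c th w].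
have mbad1 : measurable bad1.
  by apply: (@measurable_le_IPGAP _ _ _ _ _ A c) => *; exact: measurable_funPT.
have mbad2 : measurable bad2.
  by apply: measurable_setler => //; exact: measurable_total_weight.
have pbad2 : (P bad2 <= (n%:R ^- 7)%:E)%E.
  apply: le_trans (total_weight_tail iid th0 M0) _; rewrite lee_fin.
  rewrite card_ffun card_sum !card_ord natrX ler_pdivrMr // /M [leRHS]mulrC mulfK.
    by rewrite ler_wpM2l // ltW.
  by rewrite expf_neq0 // lt0r_neq0.
(* The good event: integrality gap below [g] and total weight below [M]. *)
exists (~` (bad1 `|` bad2)); split.
- by apply: measurableC; exact: measurableU.
- move=> w /not_orP[good1 /negP]; rewrite -ltNge => good2 tree [[inc reach] _].
  have near_opt : exists2 y, ip_feasible (random_mx A w) b y &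
      (val_LP (random_mx A w) b (random_vec c w) < (g + dotp (random_vec c w) y)%:E)%E.
    (* If no integer point were within [g] of the LP value, [le_IPGAP] would make the gap at least
       [g], also in the infeasible case. *)
    apply: contrapT => h; apply: good1; apply/le_IPGAP => z fz.
    rewrite leNgt; apply/negP => lt_z; apply: h.
    by exists (\col_j (z j)%:R).
  have [f hf] := branches_near_greedy reach near_opt.
  apply: le_trans (size_bound m0 mn n3 t1 (erefl s)).
  rewrite bb_size_branches -add1n natrD lerD2l -muln2 natrM mulrC ler_wpM2l //.
  apply: (@le_trans _ _ (n%:R * #|near_greedy (random_mx A w) (random_vec c w)
    (multiplier (random_mx A w) (random_vec c w) f) g|%:R)).
    by rewrite -natrM ler_nat.
  apply: ler_wpM2l; first exact: ltW.
  apply: le_trans (card_near_greedy _ _ _ _ (ltW th0)) _.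
  rewrite thg; apply: ler_wpM2l; first exact: expR_ge0.
  apply: le_trans (prod_weights_le _ _ f (ltW th0)) _.
  apply: ler_wpM2l; first exact: exprn_ge0.
  apply: le_trans (ltW good2); rewrite /total_weight (bigD1 f) //= lerDl.
  by apply: sumr_ge0 => f' _; exact: random_weights_ge0.
- rewrite probability_setC; last exact: measurableU.
  have pU : (P (bad1 `|` bad2) <= (4 * (1 - 25^-1) `^ t + 2 / n%:R ^+ 7)%:E)%E.
    apply: le_trans (measureU2 P mbad1 mbad2) _.
    rewrite [2 / _]mulr_natl mulr2n addrA EFinD.
    by apply: leeD => //; exact: (hgap _ _ _ adm _ _ _ _ _ iid _ tb).
  apply: (@le_trans _ _ (1 - (4 * (1 - 25^-1) `^ t + 2 / n%:R ^+ 7)%:E)%E).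
    by rewrite -EFinB lee_fin opprD addrA.
  by rewrite leeB.
Qed.
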